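(* Let $n\ge1$, $D,V>0$ and $K\in\mathbb{R}$. The number of diffeomorphism classes of compact Heisenberg manifolds $\Gamma\backslash\mathbb{H}_n$ which carry a left invariant Riemannian metric $\langle\cdot,\cdot\rangle$ satisfying (1) $\mathrm{diam}(\Gamma\backslash \mathbb{H}_n,\langle\cdot,\cdot\rangle)\leq D$, (2) $\mathrm{meas}(\Gamma\backslash \mathbb{H}_n,\langle\cdot,\cdot\rangle)\geq V$, (3) $\mathrm{Ric}_{\langle\cdot,\cdot\rangle}\geq K$, is finite.
   Context: The Heisenberg Lie group $\mathbb{H}_n$ is $\mathbb{C}^n\times\mathbb{R}$ with product $(\mathbf{w},z)\cdot(\mathbf{w}',z')=(\mathbf{w}+\mathbf{w}',\,z+z'+\tfrac12\,\mathrm{Im}(\mathbf{w}\cdot\mathbf{w}'))$, where $\mathrm{Im}(\mathbf{w}\cdot\mathbf{w}')=\sum_i(x_iy_i'-y_ix_i')$ for $\mathbf w=(x_i+\sqrt{-1}\,y_i)_i$, $\mathbf w'=(x'_i+\sqrt{-1}\,y'_i)_i$. A compact Heisenberg manifold is a quotient $\Gamma\backslash\mathbb{H}_n$ with $\Gamma<\mathbb{H}_n$ a lattice (discrete cocompact subgroup). A Riemannian metric on $\Gamma\backslash\mathbb{H}_n$ is called left invariant if its pullback to the universal cover $\mathbb{H}_n$ is left invariant. The quantity $\mathrm{meas}$ is the total Riemannian volume, and $\mathrm{Ric}\ge K$ means $\mathrm{Ric}(u,u)\ge K$ for all unit tangent vectors $u$. *)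

(* Defs.v *)
From HB Require Import structures.
From mathcomp Require Import all_boot all_order all_algebra.
From mathcomp Require Import all_classical all_reals all_analysis.
Set Implicit Arguments.
Unset Strict Implicit.
Unset Printing Implicit Defensive.
Import Order.TTheory GRing.Theory Num.Theory.
Import numFieldNormedType.Exports.
Local Open Scope classical_set_scope.
Local Open Scope ring_scope.
Local Open Scope quotient_scope.

(* C^oo on an open set U: all iterated directional derivatives exist and are
   (Frechet) differentiable, hence continuous, on U. *)
Definition smooth_on (R : realType) (V W : normedModType R) (U : set V)
    (f : V -> W) : Prop :=
  forall vs : seq V,
    {in U, forall p, differentiable (foldr (fun v h => 'D_v h) f vs) p}.

(* Lebesgue measure on R^m, carried by m-tuples since matrices have no
   measurable structure in the library. *)

Section lebesgue_tuple.
Context (R : realType).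
Local Open Scope ereal_scope.
Local Notation RT m := (m.-tuple (measurableTypeR R)).

Definition tuple_cons m (p : measurableTypeR R * RT m) : RT m.+1 :=
  [tuple of p.1 :: p.2].

Lemma measurable_tuple_cons m : measurable_fun setT (@tuple_cons m).
Proof. exact: measurable_cons measurable_fst measurable_snd. Qed.

Section step.
Variables (m : nat) (lam : {sigma_finite_measure set (measurableTypeR R) -> \bar R})
  (mu : {sigma_finite_measure set (RT m) -> \bar R}).

Definition lebesgue_step : set (RT m.+1) -> \bar R :=
  pushforward (lam \x mu) (@tuple_cons m).

Let step0 : lebesgue_step set0 = 0.
Proof. by rewrite /lebesgue_step /pushforward preimage_set0 measure0. Qed.

Let step_ge0 A : 0 <= lebesgue_step A.
Proof. by rewrite /lebesgue_step /pushforward; exact: measure_ge0. Qed.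

Let step_additive : semi_sigma_additive lebesgue_step.
Proof.
move=> F mF tF mUF; rewrite /lebesgue_step /pushforward preimage_bigcup.
apply: measure_semi_sigma_additive.
- by move=> k; rewrite -[X in measurable X]setTI; exact: measurable_tuple_cons.
- apply/trivIsetP => /= i j _ _ ij; rewrite -preimage_setI.
  by move/trivIsetP : tF => /(_ _ _ _ _ ij) ->//; rewrite preimage_set0.
- rewrite -preimage_bigcup -[X in measurable X]setTI.
  exact: measurable_tuple_cons.
Qed.

HB.instance Definition _ := isMeasure.Build _ _ _ lebesgue_step
  step0 step_ge0 step_additive.

Let step_sigma_finite : sigma_finite setT lebesgue_step.
Proof.
have /sigma_finiteP[F [TF ndF Foo]] := sigma_finiteT lam.
have /sigma_finiteP[G [TG ndG Goo]] := sigma_finiteT mu.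
pose uncons (t : RT m.+1) : measurableTypeR R * RT m :=
  (tnth t ord0, [tuple of behead t]).
have unconsK p : uncons (tuple_cons p) = p.
  by case: p => x t; congr pair; apply: val_inj.
have muncons : measurable_fun setT uncons.
  apply/measurable_fun_pairP; split; first exact: measurable_tnth.
  exact: measurable_behead.
exists (fun k => uncons @^-1` (F k `*` G k)).
  apply/esym; rewrite -subTset => t _.
  have [i _ Fi] : (\bigcup_k F k) (uncons t).1 by rewrite -TF.
  have [j _ Gj] : (\bigcup_k G k) (uncons t).2 by rewrite -TG.
  exists (maxn i j) => //; split.
    by move: Fi; exact/subsetPset/ndF/leq_maxl.
  by move: Gj; exact/subsetPset/ndG/leq_maxr.
move=> k; have [mF Foo'] := Foo k; have [mG Goo'] := Goo k.
have mFG : measurable (F k `*` G k) by exact: measurableX.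
split; first by rewrite -[X in measurable X]setTI; exact: muncons.
rewrite /lebesgue_step /pushforward.
rewrite (_ : _ @^-1` _ = F k `*` G k).
  by rewrite product_measure1E// lte_mul_pinfty// ge0_fin_numE.
by apply/seteqP; split=> p; rewrite /preimage /mkset unconsK.
Qed.

HB.instance Definition _ := Measure_isSigmaFinite.Build _ _ _ lebesgue_step
  step_sigma_finite.

End step.

Fixpoint lebesgue_tuple m : {sigma_finite_measure set (RT m) -> \bar R} :=
  match m with
  | 0 => \d_([tuple] : RT 0)
  | m'.+1 => lebesgue_step (@lebesgue_measure R) (lebesgue_tuple m')
  end.

End lebesgue_tuple.

(* Riemannian geometry on R^m in its global chart: a metric is the field of its
   Gram matrices g p in the standard coordinates. *)

Section riemannian.
Context (R : realType) (m : nat).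
Local Notation E := 'rV[R]_m.
Implicit Types (g : E -> 'M[R]_m) (p u v : E) (i j k l : 'I_m) (c : R -> E).

Definition inner g p u v : R := (u *m g p *m v^T) ord0 ord0.

Definition riemannian_metric g : Prop :=
  [/\ forall i j, smooth_on setT (fun p => g p i j : R^o),
      forall p u v, inner g p u v = inner g p v u &
      forall p u, u != 0 -> 0 < inner g p u u].

Definition partial i (f : E -> R) p : R := 'D_(delta_mx 0 i) (f : E -> R^o) p.

(* Gamma^k_{ij} *)
Definition christoffel g k i j p : R :=
  2^-1 * \sum_l invmx (g p) k l *
    (partial i (fun q => g q j l) p + partial j (fun q => g q i l) p
     - partial l (fun q => g q i j) p).

(* R^l_{ijk}, where R(d_i, d_j) d_k = \sum_l R^l_{ijk} d_l and
   R(X, Y) = [nabla_X, nabla_Y] - nabla_[X, Y] *)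
Definition curvature g l i j k p : R :=
  partial i (christoffel g l j k) p - partial j (christoffel g l i k) p
  + \sum_r (christoffel g l i r p * christoffel g r j k p
            - christoffel g l j r p * christoffel g r i k p).

(* Ric(u, v) = tr (w |-> R(w, u) v) *)
Definition ricci g p u v : R :=
  \sum_j \sum_k u ord0 j * v ord0 k * \sum_i curvature g i i j k p.

(* The projection of the Heisenberg group onto a quotient is a local isometry, so
   a Ricci bound for the quotient is the same as one for the pulled back metric. *)
Definition ricci_ge g (K : R) : Prop :=
  forall p u, inner g p u u = 1 -> K <= ricci g p u u.

Definition C1_curve c : Prop :=
  (forall t : R, derivable c t 1) /\ continuous (derive1 c).

(* A piecewise C^1 curve from p to q is a chain of C^1 arcs, each one
   parametrized by [0, 1] (a C^1 arc on [0, 1] extends to a C^1 curve on R). *)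
Fixpoint piecewise_C1 p (cs : seq (R -> E)) q : Prop :=
  if cs is c :: cs' then [/\ C1_curve c, c 0 = p & piecewise_C1 (c 1) cs' q]
  else p = q.

Definition arc_length g c : \bar R :=
  (\int[@lebesgue_measure R]_(t in `[0%R, 1%R])
     (Num.sqrt (inner g (c t) (derive1 c t) (derive1 c t)))%:E)%E.

Definition curve_length g (cs : seq (R -> E)) : \bar R :=
  (\sum_(c <- cs) arc_length g c)%E.

Definition row_of_tuple (t : m.-tuple (measurableTypeR R)) : E :=
  \row_i tnth t i.

Definition borel (A : set E) : Prop := measurable (row_of_tuple @^-1` A).

Definition riemannian_volume g (A : set E) : \bar R :=
  (\int[@lebesgue_tuple R m]_(t in row_of_tuple @^-1` A)
     (Num.sqrt (\det (g (row_of_tuple t))))%:E)%E.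

End riemannian.

(* The point (x_1, .., x_n, y_1, .., y_n, z) stands for (x + iy, z) in C^n x R. *)
Notation heis R n := 'rV[R]_(n + n + 1).

Section heisenberg.
Context (R : realType) (n : nat).
Implicit Types (p q h : heis R n).

Definition hx p : 'rV[R]_n := lsubmx (lsubmx p).
Definition hy p : 'rV[R]_n := rsubmx (lsubmx p).

(* Im(w . w') *)
Definition symp p q : R :=
  \sum_i (hx p ord0 i * hy q ord0 i - hy p ord0 i * hx q ord0 i).

Definition central (z : R) : heis R n := row_mx 0 (const_mx z).

Definition hmul p q : heis R n := p + q + central (2^-1 * symp p q).

Lemma hx_hmul p q : hx (hmul p q) = hx p + hx q.
Proof. by rewrite /hx !linearD /= row_mxKl !linear0 addr0. Qed.

Lemma hy_hmul p q : hy (hmul p q) = hy p + hy q.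
Proof. by rewrite /hy !linearD /= row_mxKl !linear0 addr0. Qed.

Lemma central0 : central 0 = 0.
Proof. exact: row_mx0. Qed.

Lemma centralD a b : central (a + b) = central a + central b.
Proof.
rewrite /central add_row_mx addr0; congr row_mx.
by apply/rowP => i; rewrite !mxE.
Qed.

Lemma sympDl p p' q q' : hx q' = hx p + hx p' -> hy q' = hy p + hy p' ->
  symp q' q = symp p q + symp p' q.
Proof.
move=> ex ey; rewrite /symp -big_split; apply: eq_bigr => i _ /=.
rewrite ex ey !mxE !mulrDl opprD; rewrite addrACA//.
Qed.

Lemma sympC p q : symp p q = - symp q p.
Proof.
rewrite /symp -sumrN; apply: eq_bigr => i _.
by rewrite opprB mulrC [X in _ - X]mulrC.
Qed.

Lemma hmulA : associative hmul.
Proof.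
move=> p q r.
have hmulE u v : hmul u v = u + v + central (2^-1 * symp u v) by [].
rewrite (hmulE p) (hmulE (hmul p q)) (sympDl _ (hx_hmul p q) (hy_hmul p q)).
rewrite sympC (sympDl _ (hx_hmul q r) (hy_hmul q r)) opprD -!sympC.
rewrite !mulrDr !centralD (hmulE q) (hmulE p q) !addrA.
by rewrite [p + q + _ + r]addrAC [RHS]addrAC; congr (_ + _); exact: addrAC.
Qed.

Lemma hmul0p p : hmul 0 p = p.
Proof.
rewrite /hmul add0r /symp big1 ?mulr0 ?central0 ?addr0// => i _.
by rewrite /hx /hy !linear0 !mxE !mul0r subr0.
Qed.

Lemma hmulNp p : hmul (- p) p = 0.
Proof.
rewrite /hmul addNr /symp big1 ?mulr0 ?central0 ?addr0// => i _.
by rewrite /hx /hy !linearN !mxE !mulNr opprK addrC mulrC subrr.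
Qed.

(* By hmulNp, - p is the inverse of p for hmul. *)
Record subgroup := Subgroup {
  carrier : set (heis R n);
  _ : carrier 0;
  _ : forall p q, carrier p -> carrier q -> carrier (hmul p q);
  _ : forall p, carrier p -> carrier (- p) }.

Section quotient.
Variable Gam : subgroup.

Definition same_orbit p q : bool := `[< exists2 h, carrier Gam h & q = hmul h p >].

Lemma same_orbit_refl : reflexive same_orbit.
Proof.
by move=> p; apply/asboolP; exists 0; [case: Gam | rewrite hmul0p].
Qed.

Lemma same_orbit_sym : symmetric same_orbit.
Proof.
suff H p q : same_orbit p q -> same_orbit q p by move=> p q; apply/idP/idP => /H.
move=> /asboolP[h Gh ->]; apply/asboolP; exists (- h).
  by case: Gam Gh => S _ _ + /=; exact.
by rewrite hmulA hmulNp hmul0p.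
Qed.

Lemma same_orbit_trans : transitive same_orbit.
Proof.
move=> q p r /asboolP[h Gh ->] /asboolP[h' Gh' ->]; apply/asboolP.
exists (hmul h' h); last by rewrite hmulA.
by case: Gam Gh Gh' => S _ + _ /= => SM ? ?; exact: SM.
Qed.

Definition orbit_equiv :=
  EquivRel same_orbit same_orbit_refl same_orbit_sym same_orbit_trans.

Definition heis_quot := {eq_quot orbit_equiv}.
HB.instance Definition _ :=
  Topological.copy heis_quot (quotient_topology heis_quot).
HB.instance Definition _ := Quotient.on heis_quot.

End quotient.

Record lattice := Lattice {
  lattice_subgroup :> subgroup;
  _ : carrier lattice_subgroup `<=` isolated (carrier lattice_subgroup);
  _ : compact [set: heis_quot lattice_subgroup] }.

(* The smooth structure on the quotient makes the projection a local
   diffeomorphism: smooth maps are those with smooth local lifts. *)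
Definition smooth_map (Gam Gam' : lattice)
    (f : heis_quot Gam -> heis_quot Gam') : Prop :=
  forall p, exists U : set (heis R n), exists F : heis R n -> heis R n,
    [/\ open U, U p, smooth_on U F &
        forall q, U q ->
          f (\pi_(heis_quot Gam) q) = \pi_(heis_quot Gam') (F q)].

Definition diffeomorphic (Gam Gam' : lattice) : Prop :=
  exists (f : heis_quot Gam -> heis_quot Gam')
         (f' : heis_quot Gam' -> heis_quot Gam),
    [/\ smooth_map f, smooth_map f', cancel f f' & cancel f' f].

Definition diffeo_class (Gam : lattice) : set lattice :=
  [set Gam' | diffeomorphic Gam Gam'].

(* A left invariant metric on the quotient is given by its pullback g to the
   Heisenberg group: such a g is invariant under Gam, hence descends. *)
Definition left_invariant (g : heis R n -> 'M[R]_(n + n + 1)) : Prop :=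
  forall h p u v, inner g (hmul h p) ('d (hmul h) p u) ('d (hmul h) p v)
                  = inner g p u v.

Section geometry.
Variables (Gam : lattice) (g : heis R n -> 'M[R]_(n + n + 1)).
Implicit Types a b : heis_quot Gam.

(* Piecewise C^1 curves in the quotient are the projections of piecewise C^1
   curves in the Heisenberg group, and the projection preserves lengths. *)
Definition quot_dist a b : \bar R :=
  ereal_inf [set L | exists p q cs,
    [/\ \pi_(heis_quot Gam) p = a, \pi_(heis_quot Gam) q = b,
        piecewise_C1 p cs q & L = curve_length g cs]].

Definition quot_diam : \bar R :=
  ereal_sup [set L | exists a b, L = quot_dist a b].

Definition fundamental_domain (F : set (heis R n)) : Prop :=
  borel F /\ forall a, exists! p, F p /\ \pi_(heis_quot Gam) p = a.

(* All Borel fundamental domains have the same volume. *)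
Definition quot_meas : \bar R :=
  ereal_sup [set riemannian_volume g F | F in fundamental_domain].

End geometry.

End heisenberg.

(* Main.v *)
Require Import Defs.
From HB Require Import structures.
From mathcomp Require Import all_boot all_order all_algebra.
From mathcomp Require Import all_classical all_reals all_analysis.
From mathcomp Require Import measurable_realfun ring lra zify.
Set Implicit Arguments.
Unset Strict Implicit.
Unset Printing Implicit Defensive.
Import Order.TTheory GRing.Theory Num.Theory.
Import numFieldNormedType.Exports.
Local Open Scope classical_set_scope.
Local Open Scope ring_scope.
Local Open Scope quotient_scope.

(* Let k = 2n and project the lattice Gam to C^n.  The diameter bound makes the
   projection a (D + 1)-net, so Gam contains gamma_1, .., gamma_k whose projections
   form a basis of C^n consisting of vectors of bounded length.  If c generates
   the centre of Gam, the commutators of the gamma_i are integer multiples A_ij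
   of c.  The Ricci curvature in a direction u orthogonal to the centre is
   -1/2 |Z|^2 |om(u, .)|^2, with om the symplectic form and Z the central vector
   (0, 1), so the Ricci bound controls |om| |Z|, hence |A_ij| c |Z|.  Since the
   volume is at most (2(D + 1))^k c |Z|, the volume bound keeps c |Z| away from 0,
   and the A_ij are bounded.

   In the basis (gamma_1, .., gamma_k, c) the group law depends on A only, and the
   coordinates of the elements of Gam lie in (1 / 2N) Z with N = |det A|.  Hence
   Gam is determined, up to a linear automorphism of the Heisenberg group, by A
   and by the subset of {0, .., 2N - 1}^(k + 1) that corresponds to the elements
   of Gam with coordinates in [0, 1): finitely many possibilities. *)

(** * Lebesgue measure under triangular affine maps *)

(** The [gamma_i] need not generate the lattice. Lattice elements close to prescribed points come
    directly from the net, whereas a short genuine basis would call for reduction theory. The price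
    is that elements of the lattice may have fractional coordinates in this frame; since the
    symplectic form is nondegenerate, [det A] is nonzero and controls their denominators.

    The centre is the last coordinate, so left translations are affine maps with unipotent upper
    triangular linear part. For the same reason the metric at 0 is factored as [L *m L^T] with [L]
    upper triangular: [p *m L] is then an orthonormal coordinate vector whose last axis is the
    centre, and its other entries do not see the central coordinate of [p]. Every change of
    variables in a volume computation is therefore triangular, and for such maps Fubini and an
    induction on the dimension suffice.

    Left invariance lets the curvature be computed at 0 only. There one needs Ricci on vectors
    orthogonal to the centre, because moving a vector along the centre changes neither its
    projection nor its commutators. *)

Section triangular_change_of_variables.
Context (R : realType).
Local Notation RT m := (m.-tuple (measurableTypeR R)).
Local Notation leb := (@lebesgue_measure R).
Local Open Scope ereal_scope.

Lemma measurable_affine (a b : R) :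
  measurable_fun [set: measurableTypeR R]
    ((fun x => a * x + b)%R : measurableTypeR R -> measurableTypeR R).
Proof.
by apply: measurable_funD => //; exact: measurable_funM.
Qed.

Lemma lebesgue_affine (a b : R) (A : set (measurableTypeR R)) : (0 < a)%R ->
  measurable A -> a%:E * leb [set x | A (a * x + b)%R] = leb A.
Proof.
move=> a0 mA.
pose f : measurableTypeR R -> measurableTypeR R := fun x => (a * x + b)%R.
have mf : measurable_fun setT f by exact: measurable_affine.
pose an := NngNum (ltW a0).
pose mf' := isMeasurableFun.Build _ _ _ _ _ mf.
pose ff : {mfun _ >-> _} := HB.pack f mf'.
rewrite [RHS](@lebesgue_measure_unique _ (mscale an (pushforward leb ff)))//.
move=> _ [[u v] /= uv <-].
rewrite /mscale /= /pushforward.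
rewrite (_ : f @^-1` _ = `]((u - b) / a)%R, ((v - b) / a)%R]%classic); last first.
  apply/seteqP; split => x /=; rewrite !in_itv /= /f;
  by rewrite ltr_pdivrMr// ler_pdivlMr// ltrBlDr lerBrDr mulrC.
rewrite !lebesgue_measure_itv /= !lte_fin ltr_pM2r ?invr_gt0// ltrD2r.
case: ifPn => _; last by rewrite mule0.
by rewrite -!EFinB -EFinM -mulrBl mulrC divfK ?gt_eqF// opprB addrA subrK.
Qed.

Lemma ge0_integral_affine (a b : R) (F : measurableTypeR R -> \bar R) :
  (0 < a)%R -> measurable_fun setT F -> (forall x, 0 <= F x) ->
  a%:E * \int[leb]_x F (a * x + b)%R = \int[leb]_x F x.
Proof.
move=> a0 mF F0.
pose f : measurableTypeR R -> measurableTypeR R := fun x => (a * x + b)%R.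
have mf : measurable_fun setT f by exact: measurable_affine.
have := @ge0_integral_pushforward _ _ _ _ _ f mf leb setT F measurableT mF.
rewrite preimage_setT => /= <- //.
rewrite -[a%:E]/((NngNum (ltW a0))%:num%:E) -ge0_integral_mscale//.
by apply: eq_measure_integral => A mA _; exact: (lebesgue_affine b a0 mA).
Qed.

Definition affine_tuple m (U : 'M[R]_m) (d : 'rV[R]_m) (t : RT m) : RT m :=
  [tuple (row_of_tuple t *m U + d)%R ord0 i | i < m].

Lemma row_affine_tuple m (U : 'M[R]_m) d t :
  row_of_tuple (affine_tuple U d t) = (row_of_tuple t *m U + d)%R.
Proof. by apply/rowP => i; rewrite mxE tnth_mktuple. Qed.

Lemma measurable_affine_tuple m (U : 'M[R]_m) d :
  measurable_fun setT (affine_tuple U d).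
Proof.
apply/measurable_fun_tnthP => i.
have -> : (fun t : RT m => tnth t i) \o affine_tuple U d =
    (fun t => \sum_j tnth t j * U j i + d ord0 i)%R.
  apply/funext => t /=; rewrite tnth_mktuple !mxE; congr (_ + _)%R.
  by apply: eq_bigr => j _; rewrite mxE.
apply: measurable_funD => //; apply: measurable_sum => j.
by apply: measurable_funM => //; exact: measurable_tnth.
Qed.

Lemma row_of_tuple_cons m x (t : RT m) :
  row_of_tuple (tuple_cons (x, t)) = row_mx (const_mx x : 'rV_1) (row_of_tuple t).
Proof.
apply/rowP => i; rewrite !mxE.
by case: (@split_ordP 1 m i) => k ->; rewrite !mxE (tnth_nth 0%R)/= -?tnth_nth ?ord1.
Qed.

(** The vanishing lower left block keeps the tail out of the first coordinate of the image. For
    fixed [x] the tail undergoes an affine map whose linear part does not depend on [x], which is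
    the form that Fubini requires. *)
Lemma affine_tuple_cons m (U : 'M[R]_(1 + m)) (d : 'rV[R]_(1 + m)) x (t : RT m) :
  dlsubmx U = 0%R ->
  affine_tuple (m := m.+1) U d (tuple_cons (x, t)) =
  tuple_cons ((U ord0 ord0 * x + d ord0 ord0)%R,
    affine_tuple (drsubmx U) (x *: ursubmx U + rsubmx d)%R t).
Proof.
move=> Ul0.
have row_inj (u v : RT m.+1) : row_of_tuple u = row_of_tuple v -> u = v.
  by move=> uv; apply: eq_from_tnth => i; have /rowP/(_ i) := uv; rewrite !mxE.
apply: row_inj; rewrite row_affine_tuple !row_of_tuple_cons row_affine_tuple.
rewrite -[U in LHS](@submxK _ 1 m 1 m) Ul0 -[d in LHS](@hsubmxK _ 1 1 m).
rewrite [X in (X + _)%R](_ : _ = row_mx (const_mx x *m ulsubmx U)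
    (const_mx x *m ursubmx U + row_of_tuple t *m drsubmx U))%R; last first.
  apply: etrans (@mul_row_block _ 1 1 m 1 m _ _ _ _ _ _) _.
  by rewrite mulmx0 addr0.
apply: etrans (@add_row_mx _ 1 1 m _ _ _ _) _.
apply: (@f_equal2 _ _ _ (@row_mx _ 1 1 m)).
  apply/rowP => i; rewrite !ord1 !mxE big_ord1 !mxE [(x * _)%R]mulrC.
  have l0 : lshift m (ord0 : 'I_1) = ord0 :> 'I_(1 + m) by apply/val_inj.
  by rewrite l0.
rewrite [RHS]addrA; congr (_ + _)%R; rewrite addrC; congr (_ + _)%R.
by apply/rowP => i; rewrite !mxE big_ord1 !mxE.
Qed.

Lemma lebesgue_tupleS m (A : set (RT m.+1)) :
  lebesgue_tuple R m.+1 A =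
  \int[leb]_x lebesgue_tuple R m [set t | A (tuple_cons (x, t))].
Proof.
apply: eq_integral => x _; congr (lebesgue_tuple R m _).
by apply/seteqP; split => t; rewrite /xsection /= inE.
Qed.

Definition upper_triangular m (U : 'M[R]_m) :=
  (forall i j : 'I_m, (j < i)%N -> U i j = 0%R) /\ forall i, (0 < U i i)%R.

Lemma upper_triangular_block m (U : 'M[R]_(1 + m)) : upper_triangular U ->
  [/\ (0 < U ord0 ord0)%R, dlsubmx U = 0%R, upper_triangular (drsubmx U) &
      (\det U = U ord0 ord0 * \det (drsubmx U))%R].
Proof.
move=> [Ul Ud].
have dl0 : dlsubmx U = 0%R by apply/matrixP => i j; rewrite !mxE Ul// ord1.
have drU : upper_triangular (drsubmx U).
  by split => [i j ij|i]; rewrite !mxE//; exact: Ul.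
split=> //.
rewrite -[U in LHS](@submxK _ 1 m 1 m) dl0 det_ublock; congr (_ * _)%R.
rewrite [ulsubmx U]mx11_scalar det_scalar1 !mxE.
by congr (U _ _); apply/val_inj.
Qed.

Lemma upper_triangular_det m (U : 'M[R]_m) : upper_triangular U ->
  \det U = (\prod_i U i i)%R.
Proof.
move=> [Ul _]; rewrite -det_tr det_trig; last first.
  by apply/is_trig_mxP => i j ij; rewrite mxE Ul.
by apply: eq_bigr => i _; rewrite mxE.
Qed.

Lemma measurable_preimage_affine_tuple m (U : 'M[R]_m) d (A : set (RT m)) :
  measurable A -> measurable (affine_tuple U d @^-1` A).
Proof. by move=> mA; rewrite -[X in measurable X]setTI; exact: measurable_affine_tuple. Qed.

(** Induction on the dimension: for a fixed first coordinate the induction hypothesis handles the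
    tail, and the remaining integral is a one-dimensional affine substitution. *)
Lemma lebesgue_affine_tuple m (U : 'M[R]_m) d (A : set (RT m)) :
  upper_triangular U -> measurable A ->
  (\det U)%:E * lebesgue_tuple R m (affine_tuple U d @^-1` A) =
  lebesgue_tuple R m A.
Proof.
elim: m U d A => [|m IH] U d A.
  move=> _ _; rewrite det_mx00 mul1e; congr (lebesgue_tuple R 0 _).
  by apply/funext => t; rewrite /preimage /mkset [affine_tuple _ _ _]tuple0 [t]tuple0.
move=> /(@upper_triangular_block m)[U00 Udl Udr detU] mA.
have mS (B : set (RT m.+1)) x : measurable B ->
    measurable [set t | B (tuple_cons (x, t))].
  move=> mB; rewrite -[X in measurable X]setTI.
  apply: (measurableT_comp (@measurable_tuple_cons R m) (@pair1_measurable _ _ _ _ x)) => //.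
rewrite !lebesgue_tupleS detU EFinM -muleA.
pose F (B : set (RT m.+1)) x := lebesgue_tuple R m [set t | B (tuple_cons (x, t))].
have mF B : measurable B -> measurable_fun [set: measurableTypeR R] (F B).
  move=> mB; have mB' : measurable (@tuple_cons R m @^-1` B).
    by rewrite -[X in measurable X]setTI; exact: measurable_tuple_cons.
  have := measurable_fun_xsection (lebesgue_tuple R m) mB'.
  apply: eq_measurable_fun => x _ /=; congr (lebesgue_tuple R m _).
  by apply/seteqP; split => t; rewrite /xsection /= inE.
rewrite -[RHS](@ge0_integral_affine _ (d ord0 ord0) (F A) U00 (mF _ mA)) //.
congr (_ * _); rewrite -ge0_integralZl//; first last.
- by rewrite lee_fin ltW// upper_triangular_det//; case: Udr => _ Ud; exact: prodr_gt0.
- by apply: (mF (affine_tuple (m := m.+1) U d @^-1` A));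
  exact: measurable_preimage_affine_tuple.
apply: eq_integral => x _ /=; rewrite -[RHS](IH _ (x *: ursubmx (U : 'M[R]_(1 + m)) +
  rsubmx (d : 'rV[R]_(1 + m)))%R _ Udr (mS A _ mA)).
congr (_ * lebesgue_tuple R m _).
by apply/seteqP; split => t; rewrite /preimage /= affine_tuple_cons.
Qed.

Lemma measurable_box m (a b : 'I_m -> R) :
  measurable [set t : RT m | forall i, tnth t i \in `[a i, b i]].
Proof.
rewrite (_ : mkset _ =
    \bigcap_i ((fun t => tnth t i) @^-1` `[a i, b i]%classic)); last first.
  by apply/seteqP; split => [t H i _|t H i]; apply: H.
apply: fin_bigcap_measurable => // i _.
rewrite -[X in measurable X]setTI; exact: measurable_tnth.
Qed.

Lemma lebesgue_tuple_box m (a b : 'I_m -> R) : (forall i, a i <= b i)%R ->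
  lebesgue_tuple R m [set t | forall i, tnth t i \in `[a i, b i]] =
  (\prod_i (b i - a i))%:E.
Proof.
elim: m a b => [|m IH] a b ab.
  rewrite big_ord0 /= diracE mem_set// => -[]//.
rewrite [LHS](_ : _ = (leb \x lebesgue_tuple R m) (`[a ord0, b ord0]%classic `*`
   [set t | forall i, tnth t i \in `[a (lift ord0 i), b (lift ord0 i)]])).
  rewrite product_measure1E//; last exact: measurable_box.
  rewrite big_ord_recl EFinM -IH//; congr (_ * _).
  apply: etrans (lebesgue_measure_itv _) _; rewrite /= lte_fin.
  case: ifPn => //; rewrite -leNgt => ba.
  by rewrite (@le_anti _ _ (a ord0) (b ord0)) ?ab ?ba// subrr.
congr (product_measure1 _ _ _); apply/seteqP; split => -[x t] /= H.
  split; first by have := H ord0; rewrite (tnth_nth 0%R).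
  by move=> i; have := H (lift ord0 i); rewrite !(tnth_nth 0%R).
by move=> i; case: (unliftP ord0 i) => [j|] ->; case: H => H0 H;
  [have := H j|move: H0]; rewrite !(tnth_nth 0%R).
Qed.

Lemma lebesgue_parallelepiped m (U : 'M[R]_m) (a b : 'I_m -> R) :
  upper_triangular U -> (forall i, a i <= b i)%R ->
  (\det U)%:E * lebesgue_tuple R m
    [set t | forall i, (row_of_tuple t *m U)%R ord0 i \in `[a i, b i]] =
  (\prod_i (b i - a i))%:E.
Proof.
move=> Utr ab; rewrite -lebesgue_tuple_box//.
rewrite -(lebesgue_affine_tuple 0%R Utr (measurable_box a b)).
congr (_ * lebesgue_tuple R m _); apply/seteqP.
by split => t H i; have := H i; rewrite tnth_mktuple addr0.
Qed.

End triangular_change_of_variables.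

(** * Lattices in adapted coordinates *)

Section heisenberg_algebra.
Context (R : realType) (n : nat).
Local Notation H := (heis R n).
Implicit Types (p q h : H) (S : subgroup R n).

Lemma symp_is_linear p : linear (symp p : H -> R^o).
Proof.
move=> a u v; rewrite /symp scaler_sumr -big_split; apply: eq_bigr => i _ /=.
rewrite /hx /hy !linearP /= !mxE /GRing.scale /=; ring.
Qed.

HB.instance Definition _ p :=
  GRing.isLinear.Build R H R^o *:%R (symp p) (symp_is_linear p).

Lemma symp_scaler a p q : symp p (a *: q) = a * symp p q.
Proof. by rewrite linearZ. Qed.

Lemma symp_scalel a p q : symp (a *: p) q = a * symp p q.
Proof. by rewrite sympC symp_scaler -mulrN -sympC. Qed.

Lemma symp_0l p : symp 0 p = 0.
Proof. by rewrite -(scale0r (0 : H)) symp_scalel mul0r. Qed.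

Lemma symp_addr p q q' : symp p (q + q') = symp p q + symp p q'.
Proof. by rewrite linearD. Qed.

Lemma symp_addl p p' q : symp (p + p') q = symp p q + symp p' q.
Proof. by rewrite sympC linearD /= !(sympC q) opprD !opprK. Qed.

Lemma symp_oppl p q : symp (- p) q = - symp p q.
Proof. by rewrite -scaleN1r symp_scalel mulN1r. Qed.

Lemma symp_oppr p q : symp p (- q) = - symp p q.
Proof. by rewrite linearN. Qed.

Lemma sympp p : symp p p = 0.
Proof. by have := sympC p p; lra. Qed.

Lemma symp_centralr p z : symp p (central n z) = 0.
Proof.
rewrite /symp big1// => i _.
by rewrite /hx /hy /central row_mxKl !linear0 !mxE !mulr0 subrr.
Qed.

Lemma symp_centrall p z : symp (central n z) p = 0.
Proof. by rewrite sympC symp_centralr oppr0. Qed.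

Lemma symp_suml I (r : seq I) (F : I -> H) q :
  symp (\sum_(i <- r) F i) q = \sum_(i <- r) symp (F i) q.
Proof.
elim/big_rec2: _ => [|i a b _ <-]; last by rewrite symp_addl.
exact: symp_0l.
Qed.

Lemma symp_nondegenerate p : (forall q, symp p q = 0) -> lsubmx p = 0.
Proof.
move=> p0; rewrite -[lsubmx p]hsubmxK.
suff [hx0 hy0] : hx p = 0 /\ hy p = 0.
  by rewrite -/(hx p) -/(hy p) hx0 hy0 row_mx0.
split; apply/rowP => i; rewrite [RHS]mxE.
  have := p0 (row_mx (row_mx 0 (delta_mx 0 i)) 0).
  rewrite /symp (bigD1 i)//= big1 => [|j ji]; rewrite /hx /hy !row_mxKl row_mxKr !mxE.
    by rewrite !eqxx mulr1 mulr0 subr0 addr0.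
  by rewrite (negbTE ji) !mulr0 subrr.
have := p0 (row_mx (row_mx (delta_mx 0 i) 0) 0).
rewrite /symp (bigD1 i)//= big1 => [|j ji]; rewrite /hx /hy !row_mxKl row_mxKr !mxE.
  by rewrite !eqxx mulr1 mulr0 sub0r addr0 => /eqP; rewrite oppr_eq0 => /eqP.
by rewrite (negbTE ji) !mulr0 subrr.
Qed.

Lemma centralZ (a z : R) : central n (a * z) = a *: central n z.
Proof.
by rewrite /central scale_row_mx scaler0; congr row_mx; apply/rowP => i; rewrite !mxE.
Qed.

Lemma centralN (z : R) : central n (- z) = - central n z.
Proof. by rewrite -mulN1r centralZ scaleN1r. Qed.

Lemma central_inj : injective (@central R n).
Proof. by move=> a b /eq_row_mx[_ /rowP/(_ ord0)]; rewrite !mxE. Qed.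

Lemma hmul_central p z : hmul p (central n z) = p + central n z.
Proof. by rewrite /hmul symp_centralr mulr0 central0 addr0. Qed.

Lemma hmul_centrall p z : hmul (central n z) p = p + central n z.
Proof. by rewrite /hmul symp_centrall mulr0 central0 addr0 addrC. Qed.

Lemma hmulpN p : hmul p (- p) = 0.
Proof. by rewrite -{1}[p]opprK hmulNp. Qed.

Lemma hmulp0 p : hmul p 0 = p.
Proof. by rewrite -(central0 R n) hmul_central central0 addr0. Qed.

Lemma hmul_commutator p q :
  hmul (hmul p q) (hmul (- p) (- q)) = central n (symp p q).
Proof.
rewrite [hmul (- p) _]/hmul symp_oppl symp_oppr opprK /hmul.
rewrite !symp_addl !symp_addr symp_centralr symp_centrall !symp_oppr !sympp.
rewrite (sympC q p) symp_centralr.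
rewrite symp_centrall [X in _ + central n X](_ : _ = 0); last by ring.
rewrite central0 addr0 -opprD addrACA subrr add0r -centralD; congr central.
by field.
Qed.

Lemma carrier0 S : carrier S 0. Proof. by case: S. Qed.

Lemma carrierM S p q : carrier S p -> carrier S q -> carrier S (hmul p q).
Proof. by case: S => C c0 cM cN /= Cp Cq; apply: cM. Qed.

Lemma carrierN S p : carrier S p -> carrier S (- p).
Proof. by case: S => C c0 cM cN /=; apply: cN. Qed.

(** Since [symp p p = 0], the powers of [p] in the group are its integer multiples. *)
Lemma carrierZ S p a : a \is a Num.int -> carrier S p -> carrier S (a *: p).
Proof.
have N (j : nat) : carrier S p -> carrier S (j%:R *: p).
  move=> Sp; elim: j => [|j IH]; first by rewrite scale0r; exact: carrier0.
  have := carrierM IH Sp.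
  by rewrite /hmul symp_scalel sympp !mulr0 central0 addr0 -natr1 scalerDl scale1r.
move=> /intrP[[j|j] ->] Sp; first exact: N.
by rewrite NegzE mulrNz scaleNr; apply/carrierN/N.
Qed.

(* The point with coordinates (t, s) in the basis formed by the rows of G and
   the central vector of length c. *)
Definition frame_point (G : 'M[R]_(n + n, n + n + 1)) (c : R) (t : 'rV[R]_(n + n))
  (s : R) : H := t *m G + central n (s * c).

Definition symp_gram (G : 'M[R]_(n + n, n + n + 1)) : 'M[R]_(n + n) :=
  \matrix_(i, j) symp (row i G) (row j G).

Lemma frame_pointD G c t s t' s' :
  frame_point G c t s + frame_point G c t' s' = frame_point G c (t + t') (s + s').
Proof. by rewrite /frame_point mulmxDl mulrDl centralD addrACA. Qed.

Lemma frame_pointZ G c a t s :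
  a *: frame_point G c t s = frame_point G c (a *: t) (a * s).
Proof. by rewrite /frame_point scalerDr -scalemxAl -mulrA [in RHS]centralZ. Qed.

Lemma symp_frame G c t s t' s' :
  symp (frame_point G c t s) (frame_point G c t' s') =
  (t *m symp_gram G *m t'^T) ord0 ord0.
Proof.
rewrite /frame_point symp_addl !symp_addr !symp_centralr !symp_centrall !addr0.
rewrite (mulmx_sum_row t G) (mulmx_sum_row t' G) symp_suml -mulmxA [RHS]mxE; apply: eq_bigr => i _.
rewrite symp_scalel linear_sum; congr (_ * _); rewrite mxE; apply: eq_bigr => j _.
by rewrite [LHS]symp_scaler !mxE mulrC.
Qed.

Lemma hmul_frame G c (A : 'M[R]_(n + n)) t s t' s' : symp_gram G = c *: A ->
  hmul (frame_point G c t s) (frame_point G c t' s') =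
  frame_point G c (t + t') (s + s' + 2^-1 * (t *m A *m t'^T) ord0 ord0).
Proof.
move=> GA; rewrite /hmul symp_frame frame_pointD GA /frame_point.
rewrite -addrA -centralD -scalemxAr -scalemxAl mxE.
by congr (_ + central _ _); ring.
Qed.

Lemma frame_point_surj G c p : lsubmx G \in unitmx -> c != 0 ->
  exists t s, p = frame_point G c t s.
Proof.
move=> Gu c0; pose t := lsubmx p *m invmx (lsubmx G).
exists t, (rsubmx (p - t *m G) ord0 ord0 / c).
apply/eqP; rewrite /frame_point divfK// addrC -subr_eq; apply/eqP.
rewrite -[LHS]hsubmxK /central; congr row_mx.
  apply/eqP; rewrite linearB /= subr_eq0 -[X in t *m X](hsubmxK G) mul_mx_row.
  by rewrite row_mxKl /t mulmxKV.
by apply/rowP => i; rewrite ord1 [RHS]mxE.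
Qed.

(** A row vector killed by the Gram matrix gives a point that is symplectically orthogonal to every
    frame point, hence to the whole group. *)
Lemma symp_gram_unit G (c : R) : lsubmx G \in unitmx -> c != 0 -> symp_gram G \in unitmx.
Proof.
move=> Gu c0; rewrite -row_free_unit -kermx_eq0; apply/eqP/row_matrixP => i.
 rewrite row0; set t := row i _.
have tG : t *m symp_gram G = 0 by apply/sub_kermxP; exact: row_sub.
have : lsubmx (frame_point G c t 0) = 0.
  apply: symp_nondegenerate => q; have [t' [s' ->]] := frame_point_surj q Gu c0.
  by rewrite symp_frame tG mul0mx mxE.
rewrite /frame_point mul0r central0 addr0 -(hsubmxK G) mul_mx_row row_mxKl.
by move=> /(congr1 (mulmx^~ (invmx (lsubmx G)))); rewrite mulmxK// mul0mx.
Qed.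

End heisenberg_algebra.

(** * Frames of a lattice and the finite data that determine it *)

Section lattice_frames.
Context (R : realType) (n : nat).
Implicit Types (S : subgroup R n) (G : 'M[R]_(n + n, n + n + 1)) (c : R).

(* G lists elements of S whose projections form a basis of C^n, c generates the
   centre of S, and A records the commutators of the elements in G. *)
Definition adapted_frame S G c (A : 'M[int]_(n + n)) : Prop :=
  [/\ c != 0, lsubmx G \in unitmx, forall i, carrier S (row i G),
      forall z, carrier S (central n z) <-> z / c \is a Num.int &
      symp_gram G = c *: map_mx intr A].

Local Notation den A := `|\det A|%N.

Lemma adapted_frame_det S G c A : adapted_frame S G c A -> (0 < den A)%N.
Proof.
move=> [c0 Gu _ _ GA]; have := symp_gram_unit Gu c0.
rewrite GA unitmxE detZ det_map_mx unitfE mulf_eq0 negb_or intr_eq0 absz_gt0.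
by case/andP.
Qed.

Lemma adapted_frame_central S G c A j : adapted_frame S G c A ->
  j \is a Num.int -> carrier S (frame_point G c 0 j).
Proof.
by move=> [c0 _ _ Sc _] jZ; rewrite /frame_point mul0mx add0r; apply/Sc; rewrite mulfK.
Qed.

Lemma int_bilinear (A : 'M[int]_(n + n)) (t t' : 'rV[R]_(n + n)) :
  (forall i, t ord0 i \is a Num.int) -> (forall i, t' ord0 i \is a Num.int) ->
  (t *m map_mx intr A *m t'^T) ord0 ord0 \is a Num.int.
Proof.
move=> tZ t'Z; rewrite mxE; apply: rpred_sum => i _; rewrite [t'^T _ _]mxE rpredM//.
by rewrite mxE; apply: rpred_sum => j _; rewrite mxE rpredM// intr_int.
Qed.

(** Multiply integral powers of the frame elements one after the other. Each product adds half of an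
    integral value of the form [A] to the central coordinate, so this coordinate stays
    half-integral. *)
Lemma integer_frame_points S G c (A : 'M[int]_(n + n)) (t : 'rV[R]_(n + n)) :
  symp_gram G = c *: map_mx intr A -> (forall i, carrier S (row i G)) ->
  (forall i, t ord0 i \is a Num.int) ->
  exists2 s, 2 * s \is a Num.int & carrier S (frame_point G c t s).
Proof.
move=> GA SG tZ.
suff H (j : nat) : exists2 s, 2 * s \is a Num.int & carrier S
    (frame_point G c (\row_i if (i < j)%N then t ord0 i else 0) s).
  have [s sZ Ss] := H (n + n)%N; exists s => //.
  rewrite (_ : \row_i _ = t) in Ss => //.
  by apply/rowP => i; rewrite mxE ltn_ord.
elim: j => [|j [s sZ Ss]].
  exists 0; first by rewrite mulr0 rpred0.
  rewrite /frame_point mul0r central0 addr0 (_ : \row_i _ = 0).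
    by rewrite mul0mx; exact: carrier0.
  by apply/rowP => i; rewrite !mxE.
have [jn|nj] := ltnP j (n + n); last first.
  exists s => //; rewrite (_ : \row_i _ = (\row_i if (i < j)%N then t ord0 i else 0))//.
  by apply/rowP => i; rewrite !mxE !(leq_trans (ltn_ord i)) // leqW.
pose o := Ordinal jn; pose d : 'rV[R]_(n + n) := t ord0 o *: delta_mx 0 o.
have Sd : carrier S (frame_point G c d 0).
  rewrite /frame_point mul0r central0 addr0 /d -scalemxAl -rowE.
  exact: carrierZ.
have := carrierM Sd Ss; rewrite (hmul_frame _ _ _ _ GA).
set u := \row_i _; rewrite add0r.
rewrite (_ : d + u = \row_i if (i < j.+1)%N then t ord0 i else 0).
  move=> Sdu; eexists; last exact: Sdu.
  rewrite mulrDr rpredD// mulrA divff ?mul1r ?pnatr_eq0//.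
  apply: int_bilinear => i; rewrite !mxE ?rpredM ?tZ//; last by case: ifP; rewrite ?rpred0.
  exact: intr_nat.
apply/rowP => i; rewrite !mxE eqxx /= -val_eqE /= ltnS.
case: ltngtP => [ij|ij|ij]; rewrite ?mulr0 ?add0r ?mulr1 ?addr0//.
by congr (t _ _); apply/val_inj.
Qed.

(** The commutators with the frame elements are central, so [t *m A] is integral and Cramer's rule
    bounds the denominators of [t] by [N = den A]. The [N]-th power of the point, times an element
    of [S] with horizontal coordinates [- N t] and half-integral central coordinate, is again
    central; this bounds the denominator of [s] by [2 N]. *)
Lemma adapted_frame_den S G c A t s : adapted_frame S G c A ->
  carrier S (frame_point G c t s) ->
  (forall i, (den A)%:R * t ord0 i \is a Num.int) /\
  (2 * (den A)%:R) * s \is a Num.int.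
Proof.
move=> fr Sp; have [c0 Gu SG Sc GA] := fr.
have denE (x : R) : (\det A)%:~R * x \is a Num.int -> (den A)%:R * x \is a Num.int.
  by case: (\det A) => j //; rewrite NegzE abszN mulrNz mulNr rpredN.
have tAZ j : (t *m map_mx intr A) ord0 j \is a Num.int.
  have := carrierM (carrierM Sp (SG j)) (carrierM (carrierN Sp) (carrierN (SG j))).
  rewrite hmul_commutator => /Sc.
  rewrite (_ : row j G = frame_point G c (delta_mx 0 j) 0); last first.
    by rewrite /frame_point mul0r central0 addr0 -rowE.
  rewrite symp_frame GA -scalemxAr -scalemxAl mxE mulrC mulKf//.
  by rewrite trmx_delta -colE mxE.
have tZ i : (den A)%:R * t ord0 i \is a Num.int.
  apply: denE.
  have -> : (\det A)%:~R * t ord0 i =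
      (t *m map_mx intr A *m map_mx intr (\adj A)) ord0 i.
    by rewrite -mulmxA -map_mxM /= mul_mx_adj map_scalar_mx /= mul_mx_scalar mxE.
  by rewrite mxE; apply: rpred_sum => j _; rewrite rpredM// mxE intr_int.
split=> //.
have NtZ i : (- ((den A)%:R *: t)) ord0 i \is a Num.int by rewrite !mxE rpredN.
have [s' s'Z Ss'] := integer_frame_points GA SG NtZ.
have := carrierM (carrierZ (natr_int _ (den A)) Sp) Ss'.
have tt0 : (t *m map_mx intr A *m t^T) ord0 ord0 = 0.
  have := sympp (frame_point G c t 0); rewrite symp_frame GA -scalemxAr -scalemxAl mxE.
  by move=> /eqP; rewrite mulf_eq0 (negbTE c0) => /eqP.
rewrite frame_pointZ (hmul_frame _ _ _ _ GA) subrr linearN linearZ /= mulmxN.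
rewrite [X in 2^-1 * X](_ : _ = 0); last first.
  by rewrite mxE -scalemxAr -!scalemxAl scalerA mxE tt0 mulr0 oppr0.
rewrite mulr0 addr0 /frame_point mul0mx add0r => /Sc; rewrite mulfK// => h.
have -> : 2 * (den A)%:R * s = 2 * ((den A)%:R * s + s') - 2 * s' by ring.
by rewrite rpredB// rpredM// natr_int.
Qed.

Definition frame_map G c G' c' : 'M[R]_(n + n + 1) :=
  invmx (col_mx G (central n c)) *m col_mx G' (central n c').

Lemma frame_pointE G c t s :
  frame_point G c t s = row_mx t (const_mx s) *m col_mx G (central n c).
Proof.
rewrite mul_row_col /frame_point centralZ; congr (_ + _).
by apply/rowP => i; rewrite !mxE big_ord1 !mxE.
Qed.

Lemma frame_unit G c : lsubmx G \in unitmx -> c != 0 ->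
  col_mx G (central n c) \in unitmx.
Proof.
move=> Gu c0; rewrite -(hsubmxK G) /central -/(block_mx _ _ _ _) unitmxE.
rewrite det_ublock unitrM -!unitmxE Gu /= unitmxE det_mx11 mxE.
by rewrite unitfE.
Qed.

Lemma frame_mapE G c G' c' t s : lsubmx G \in unitmx -> c != 0 ->
  frame_point G c t s *m frame_map G c G' c' = frame_point G' c' t s.
Proof. by move=> Gu c0; rewrite !frame_pointE mulmxA mulmxK// frame_unit. Qed.

Lemma frame_map_hmul G c G' c' (A : 'M[R]_(n + n)) u v : lsubmx G \in unitmx -> c != 0 ->
  symp_gram G = c *: A -> symp_gram G' = c' *: A ->
  hmul u v *m frame_map G c G' c' =
  hmul (u *m frame_map G c G' c') (v *m frame_map G c G' c').
Proof.
move=> Gu c0 GA GA'; have [t [s ->]] := frame_point_surj u Gu c0.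
have [t' [s' ->]] := frame_point_surj v Gu c0.
by rewrite (hmul_frame _ _ _ _ GA) !frame_mapE// (hmul_frame _ _ _ _ GA').
Qed.

Lemma frame_mapK G c G' c' (p : heis R n) : lsubmx G \in unitmx -> c != 0 ->
  lsubmx G' \in unitmx -> c' != 0 ->
  p *m frame_map G c G' c' *m frame_map G' c' G c = p.
Proof.
move=> Gu c0 Gu' c0'; have [t [s ->]] := frame_point_surj p Gu c0.
by rewrite !frame_mapE.
Qed.

Lemma int_ratio (M : nat) (x : R) : (0 < M)%N -> 0 <= x < 1 ->
  M%:R * x \is a Num.int -> exists k : 'I_M, x = k%:R / M%:R.
Proof.
move=> M0 /andP[x0 x1] /intrP[[k|k] E]; last first.
  have : 0 <= M%:R * x by rewrite mulr_ge0.
  by rewrite E NegzE mulrNz oppr_ge0 lern0.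
have MR : 0 < M%:R :> R by rewrite ltr0n.
have kM : (k < M)%N by rewrite -(ltr_nat R) -[k%:R]E gtr_pMr.
by exists (Ordinal kM); rewrite /= -[k%:R]E mulrC mulKf// gt_eqF.
Qed.

(* Left translation by an element that lies in both lattices moves an arbitrary
   point of the first one into the fundamental box, where the two lattices are
   assumed to agree. *)
Lemma frame_map_carrier S S' G c G' c' A :
  adapted_frame S G c A -> adapted_frame S' G' c' A ->
  (forall (t : 'I_(n + n) -> 'I_(2 * den A)) (s : 'I_(2 * den A)),
    let x := \row_i ((t i)%:R / (2 * den A)%:R) in
    let y := s%:R / (2 * den A)%:R in
    carrier S (frame_point G c x y) -> carrier S' (frame_point G' c' x y)) ->
  forall p, carrier S p -> carrier S' (p *m frame_map G c G' c').
Proof.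
move=> fr fr' box p Sp.
have [c0 Gu SG Sc GA] := fr; have [c0' Gu' SG' Sc' GA'] := fr'.
set Q := frame_map G c G' c'.
have QM u v : hmul u v *m Q = hmul (u *m Q) (v *m Q) by exact: frame_map_hmul Gu c0 GA GA'.
(* The elements of [S] whose image lies in [S'] form a subgroup [T]. Applying [integer_frame_points]
   to [T] instead of [S] yields translations known to lie in both lattices. *)
pose C q := carrier S q /\ carrier S' (q *m Q).
have C0 : C 0 by split; rewrite ?mul0mx; exact: carrier0.
have CM u v : C u -> C v -> C (hmul u v).
  by case=> Su Tu [Sv Tv]; split; rewrite ?QM; exact: carrierM.
have CN u : C u -> C (- u).
  by case=> Su Tu; split; rewrite ?mulNmx; exact: carrierN.
pose T := Subgroup C0 CM CN.
have rowE0 (M : 'M[R]_(n + n, n + n + 1)) d i :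
    row i M = frame_point M d (delta_mx 0 i) 0.
  by rewrite /frame_point mul0r central0 addr0 -rowE.
have TG i : carrier T (row i G).
  by split; rewrite ?SG// (rowE0 _ c) frame_mapE// -rowE0.
have [t [s pE]] := frame_point_surj p Gu c0; rewrite pE in Sp *.
pose t0 : 'rV[R]_(n + n) := \row_i - (Num.floor (t ord0 i))%:~R.
have t0Z i : t0 ord0 i \is a Num.int by rewrite mxE rpredN intr_int.
have [s0 s0Z Ts0] := integer_frame_points (S := T) GA TG t0Z.
have := carrierM Ts0.1 Sp; rewrite (hmul_frame _ _ _ _ GA).
set s1 := s0 + s + _ => Ss1.
(* The central coordinate is reduced only now, because the horizontal translation has changed it
   from [s] to [s1]. *)
pose j : R := - (Num.floor s1)%:~R.
have jZ : j \is a Num.int by rewrite rpredN intr_int.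
have Tj : carrier T (frame_point G c 0 j).
  split; first exact: adapted_frame_central fr _.
  by rewrite frame_mapE//; exact: adapted_frame_central fr' _.
have := carrierM Tj.1 Ss1; rewrite (hmul_frame _ _ _ _ GA) !mul0mx mxE mulr0 addr0 add0r.
move=> Sb; have [NtZ NsZ] := adapted_frame_den fr Sb.
have N0 : (0 < 2 * den A)%N by rewrite muln_gt0 (adapted_frame_det fr).
have /choice[f fE] : forall i, exists k : 'I_(2 * den A),
    (t0 + t) ord0 i = k%:R / (2 * den A)%:R.
  move=> i.
  apply: int_ratio N0 _ _; last by rewrite natrM -mulrA rpredM// natr_int.
  by rewrite !mxE addrC subr_ge0 floor_le/= ltrBlDl -(@intrD R _ 1) floorD1_gt.
have [g gE] : exists g : 'I_(2 * den A), j + s1 = g%:R / (2 * den A)%:R.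
  apply: int_ratio N0 _ _; last by rewrite natrM.
  by rewrite /j addrC subr_ge0 floor_le/= ltrBlDl -(@intrD R _ 1) floorD1_gt.
have := box f g; rewrite /= -gE.
rewrite (_ : \row_i _ = t0 + t); last by apply/rowP => i; rewrite mxE -fE.
move=> /(_ Sb); rewrite -(frame_mapE G' c' _ _ Gu c0) => S'b.
have := carrierM (carrierN (carrierM Tj Ts0).2) S'b.
rewrite -/Q -mulNmx -QM; congr (carrier S' (_ *m Q)).
have -> : frame_point G c (t0 + t) (j + s1) =
    hmul (hmul (frame_point G c 0 j) (frame_point G c t0 s0)) (frame_point G c t s).
  rewrite -hmulA (hmul_frame t0 s0 _ _ GA) -/s1 (hmul_frame _ _ _ _ GA).
  by rewrite !mul0mx mxE mulr0 addr0 add0r.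
by rewrite hmulA hmulNp hmul0p.
Qed.

(** Bounded denominators leave countably many coordinate vectors. Countability is what allows a
    fundamental domain to be cut into pieces indexed by the lattice. *)
Lemma adapted_frame_countable S G c A : adapted_frame S G c A ->
  countable (carrier S).
Proof.
move=> fr; have [c0 Gu _ _ _] := fr; have N0 := adapted_frame_det fr.
pose f (z : 'rV[int]_(n + n) * int) : heis R n :=
  frame_point G c (\row_i ((z.1 ord0 i)%:~R / (den A)%:R)) (z.2%:~R / (2 * (den A)%:R)).
apply: (@sub_countable _ _ _ (range f)).
2: exact: sub_countable (card_image_le f setT) (countableP _).
apply: subset_card_le => p Sp; have [t [s pE]] := frame_point_surj p Gu c0.
have N0R : (den A)%:R != 0 :> R by rewrite pnatr_eq0 -lt0n.
rewrite pE in Sp; have [tZ sZ] := adapted_frame_den fr Sp.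
exists (\row_i Num.floor ((den A)%:R * t ord0 i), Num.floor (2 * (den A)%:R * s)) => //.
rewrite pE /f /=; congr (frame_point G c _ _).
  by apply/rowP => i; rewrite !mxE floorK// mulrC mulKf.
by rewrite floorK// mulrC mulKf// mulf_neq0// pnatr_eq0.
Qed.

(** [inv] is a relation and not a function because the invariant of a lattice depends on the choice
    of a frame; sharing one value is enough. *)
Lemma finite_image_invariant (X Y : Type) (I : finType) (E : set X) (f : X -> Y)
    (inv : X -> I -> Prop) :
  (forall x, E x -> exists i, inv x i) ->
  (forall x y i, E x -> E y -> inv x i -> inv y i -> f x = f y) ->
  finite_set (f @` E).
Proof.
move=> ex eqf.
apply: (@sub_finite_set _ _ (\bigcup_(i in [set: I]) f @` [set x | E x /\ inv x i])).
  move=> _ [x Ex <-]; have [i xi] := ex _ Ex.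
  by exists i => //; exists x.
apply: bigcup_finite => // i _.
have [->|/set0P[x [Ex xi]]] := eqVneq [set x | E x /\ inv x i] set0.
  by rewrite image_set0.
apply: (@sub_finite_set _ _ [set f x]) => // _ [y [Ey yi] <-].
by rewrite /= (eqf y x i).
Qed.

End lattice_frames.

(** * Linear isomorphisms of lattices and diffeomorphism classes *)

Section smoothness.
Context (R : realType).

(** The iterated derivative of [f \o l] along [vs] is that of [f] along [map l vs], composed with
    [l]: already the difference quotients agree. *)
Lemma smooth_comp_linear (V V' W : normedModType R) (l : {linear V -> V'})
  (U : set V') (f : V' -> W) : continuous l -> smooth_on U f ->
  smooth_on (l @^-1` U) (f \o l).
Proof.
move=> lc fs vs p; rewrite inE => Ulp.
have -> : foldr (fun v (h : V -> W) => 'D_v h) (f \o l) vs =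
    foldr (fun v (h : V' -> W) => 'D_v h) f (map l vs) \o l.
  elim: vs => //= v vs ->; apply/funext => q /=.
  rewrite /derive; set F := foldr _ _ _.
  suff -> : (fun h : R => h^-1 *: ((F \o l) (h *: v + q) - (F \o l) q)) =
    (fun h : R => h^-1 *: (F (h *: l v + l q) - F (l q))) by [].
  by apply/funext => h /=; rewrite linearP.
apply: differentiable_comp; first exact: linear_differentiable.
by apply: fs; rewrite inE.
Qed.

Lemma near_eq_differentiable (V W : normedModType R) (f g : V -> W) (x : V) :
  (\near x, f x = g x) -> differentiable f x -> differentiable g x.
Proof.
move=> fg df; have [dfc /eqaddoP dfo] := (diff_locallyP _ _).1 df.
have fgx : f x = g x by exact: nbhs_singleton fg.
have dgo : g \o shift x = cst (g x) + 'd f x +o_ 0 id.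
  have nfg : \forall y \near (0 : V), f (y + x) = g (y + x).
    by move: fg; rewrite (near_shift 0) subr0.
  apply/eqaddoP => e e0; apply: filterS2 (dfo e e0) nfg => y /= + fgy.
  by rewrite -[(_ - _) y]/(f (y + x) - (f x + 'd f x y)) fgy fgx.
by apply/diff_locallyP; rewrite (diff_unique dfc dgo).
Qed.

(** Here [l] commutes with derivatives only where those of [f] are differentiable, that is on [U];
    openness of [U] then makes the identity local enough to be differentiated again. *)
Lemma smooth_linear_comp (V W W' : normedModType R) (l : {linear W -> W'})
  (U : set V) (f : V -> W) : continuous l -> open U -> smooth_on U f ->
  smooth_on U (l \o f).
Proof.
move=> lc Uo fs vs p Up.
have E (ws : seq V) : {in U, foldr (fun v (h : V -> W') => 'D_v h) (l \o f) ws =1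
    l \o foldr (fun v (h : V -> W) => 'D_v h) f ws}.
  elim: ws => //= v ws IH q Uq.
  have nU : \near q, q \in U.
    by move: Uq; rewrite inE => Uq; near=> y; rewrite inE; near: y; exact: open_nbhs_nbhs.
  pose F := foldr (fun v (h : V -> W) => 'D_v h) f ws.
  rewrite (@near_eq_derive _ _ _ _ (l \o F)); last first.
    by apply: filterS nU => y; exact: IH.
  have dF : differentiable F q by exact: fs.
  have dl : differentiable l (F q) by exact: linear_differentiable.
  by rewrite (deriveE _ (differentiable_comp dF dl)) (diff_comp dF dl) /=
    (diff_lin _ lc) (deriveE v dF).
have dF := fs vs p Up.
have dl := linear_differentiable (foldr (fun v (h : V -> W) => 'D_v h) f vs p) lc.
apply: near_eq_differentiable (differentiable_comp dF dl).
move: Up; rewrite inE => Up; near=> y; rewrite E// inE; near: y.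
exact: open_nbhs_nbhs.
Unshelve. all: by end_near. Qed.
End smoothness.

Lemma continuous_sum (R : realType) (T : topologicalType) (V : normedModType R)
    I (r : seq I) (F : I -> T -> V) : (forall i, continuous (F i)) ->
  continuous (fun x => \sum_(i <- r) F i x).
Proof.
move=> Fc; elim: r => [|i r IH] x.
  by under eq_fun do rewrite big_nil; exact: cvg_cst.
have -> : (fun x => \sum_(j <- i :: r) F j x) =
    (fun x => F i x + \sum_(j <- r) F j x) by apply/funext => y; rewrite big_cons.
by apply: cvgD; [exact: Fc|exact: IH].
Qed.

Lemma mulmxr_continuous (R : realType) m p (Q : 'M[R]_(m, p)) :
  continuous (mulmxr Q : 'rV[R]_m -> 'rV[R]_p).
Proof.
rewrite (_ : (mulmxr Q : 'rV[R]_m -> 'rV[R]_p) =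
    (fun x : 'rV[R]_m => \sum_i x ord0 i *: row i Q)).
  apply: continuous_sum => i x.
  exact: (@cvgZr_tmp _ _ _ (nbhs x) _ (fun y : 'rV[R]_m => y ord0 i) _ _
    (@coord_continuous _ 1 m ord0 i x)).
by apply/funext => y /=; rewrite mulmx_sum_row.
Qed.

Section lattice_isomorphism.
Context (R : realType) (n : nat).
Implicit Types (Gam X : lattice R n) (Q : 'M[R]_(n + n + 1)).

Definition lattice_morphism Gam Gam' Q : Prop :=
  (forall p q, hmul p q *m Q = hmul (p *m Q) (q *m Q)) /\
  (forall p, carrier Gam p -> carrier Gam' (p *m Q)).

Definition quot_map Gam Gam' Q (a : heis_quot Gam) : heis_quot Gam' :=
  \pi_(heis_quot Gam') (repr a *m Q).

Lemma eq_quotP Gam p q : \pi_(heis_quot Gam) p = \pi_(heis_quot Gam) q <->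
  exists2 h, carrier Gam h & q = hmul h p.
Proof.
split; last by move=> H; apply/eqmodP; apply/asboolP.
by move=> /eqmodP /asboolP.
Qed.

Lemma quot_mapE Gam Gam' Q p : lattice_morphism Gam Gam' Q ->
  quot_map Gam' Q (\pi_(heis_quot Gam) p) = \pi_(heis_quot Gam') (p *m Q).
Proof.
move=> [QM QG]; apply/eq_quotP.
have [h Gh pE] : exists2 h, carrier Gam h & p = hmul h (repr (\pi_(heis_quot Gam) p)).
  by apply/eq_quotP; rewrite reprK.
by exists (h *m Q); [exact: QG|rewrite -QM -pE].
Qed.

Lemma quot_mapK Gam Gam' Q Q' : lattice_morphism Gam Gam' Q ->
  lattice_morphism Gam' Gam Q' -> Q *m Q' = 1%:M ->
  cancel (@quot_map Gam Gam' Q) (@quot_map Gam' Gam Q').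
Proof.
move=> mQ mQ' QQ' a.
rewrite -[a]reprK (quot_mapE _ mQ) (quot_mapE _ mQ').
by rewrite -mulmxA QQ' mulmx1.
Qed.

(** Diffeomorphism classes are compared as sets of lattices, so it suffices to compose a given
    diffeomorphism with a linear isomorphism; the composition of two general smooth maps never
    occurs. *)
Lemma diffeomorphic_pullback Gam Gam' X Q Q' : lattice_morphism Gam Gam' Q ->
  lattice_morphism Gam' Gam Q' -> Q *m Q' = 1%:M ->
  diffeomorphic Gam' X -> diffeomorphic Gam X.
Proof.
move=> mQ mQ' QQ' [f [f' [sf sf' fK f'K]]].
have Q'Q : Q' *m Q = 1%:M by exact: mulmx1C.
exists (f \o quot_map Gam' Q), (quot_map Gam Q' \o f'); split.
- move=> p; have [U [F [Uo Up FU FE]]] := sf (p *m Q).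
  exists (mulmxr Q @^-1` U), (F \o mulmxr Q); split => //.
  + by apply: open_comp => // ? _; exact: mulmxr_continuous.
  + by apply: smooth_comp_linear => //; exact: mulmxr_continuous.
  + by move=> q Uq; rewrite /= quot_mapE// FE.
- move=> p; have [U [F [Uo Up FU FE]]] := sf' p.
  exists U, (mulmxr Q' \o F); split => //.
  + by apply: smooth_linear_comp => //; exact: mulmxr_continuous.
  + by move=> q Uq; rewrite /= FE// quot_mapE.
- by apply: can_comp => //; exact: quot_mapK.
- by apply: can_comp => //; exact: quot_mapK.
Qed.

Lemma diffeo_class_eq Gam Gam' Q Q' : lattice_morphism Gam Gam' Q ->
  lattice_morphism Gam' Gam Q' -> Q *m Q' = 1%:M ->
  diffeo_class Gam = diffeo_class Gam'.
Proof.
move=> mQ mQ' QQ'; apply/seteqP; split => X /=;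
  apply: diffeomorphic_pullback; eauto using mulmx1C.
Qed.

End lattice_isomorphism.

(** * Finiteness from bounded commutator matrices *)

Section finiteness.
Context (R : realType) (n : nat).
Local Notation den A := `|\det A|%N.

Definition denominator_box (A : 'M[int]_(n + n)) : finType :=
  ({ffun 'I_(n + n) -> 'I_(2 * den A)} * 'I_(2 * den A))%type.

Definition box_point G c A (z : denominator_box A) : heis R n :=
  frame_point G c (\row_i ((z.1 i)%:R / (2 * den A)%:R)) (z.2%:R / (2 * den A)%:R).

Lemma diffeo_class_frame (Gam Gam' : lattice R n) G c G' c' A :
  adapted_frame Gam G c A -> adapted_frame Gam' G' c' A ->
  (forall z : denominator_box A,
    carrier Gam (box_point G c z) <-> carrier Gam' (box_point G' c' z)) ->
  diffeo_class Gam = diffeo_class Gam'.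
Proof.
move=> fr fr' box.
have [c0 Gu SG Sc GA] := fr; have [c0' Gu' SG' Sc' GA'] := fr'.
apply: (@diffeo_class_eq _ _ _ _ (frame_map G c G' c') (frame_map G' c' G c)).
- split; first by move=> p q; exact: frame_map_hmul Gu c0 GA GA'.
  apply: (frame_map_carrier fr fr') => t s /=.
  have := (box ([ffun i => t i], s)).1; rewrite /box_point /=.
  by under eq_mx do rewrite ffunE.
- split; first by move=> p q; exact: frame_map_hmul Gu' c0' GA' GA.
  apply: (frame_map_carrier fr' fr) => t s /=.
  have := (box ([ffun i => t i], s)).2; rewrite /box_point /=.
  by under eq_mx do rewrite ffunE.
- apply/row_matrixP => i; rewrite !rowE mulmxA mulmx1.
  exact: frame_mapK.
Qed.

Lemma finite_diffeo_classes (B : nat) (E : set (lattice R n)) :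
  (forall Gam, E Gam -> exists G c A, adapted_frame Gam G c A /\
     forall i j, (`|A i j| <= B)%N) ->
  finite_set [set diffeo_class Gam | Gam in E].
Proof.
move=> bnd.
(* Entries in [[-B, B]] are shifted by [B] to become ordinals below [2 B + 1]. The box depends on
   the matrix through its determinant, hence the dependent pair in [I]. *)
pose mx (a : {ffun 'I_(n + n) * 'I_(n + n) -> 'I_(B + B).+1}) : 'M[int]_(n + n) :=
  \matrix_(i, j) ((a (i, j) : nat)%:Z - B%:Z).
pose I : finType :=
  {a : {ffun 'I_(n + n) * 'I_(n + n) -> 'I_(B + B).+1} & {set denominator_box (mx a)}}.
apply: (@finite_image_invariant _ _ I E _ (fun Gam i => exists G c,
  adapted_frame Gam G c (mx (tag i)) /\ forall z : denominator_box (mx (tag i)),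
    carrier Gam (box_point G c z) <-> z \in tagged i)).
  move=> Gam /bnd[G [c [A [fr Ab]]]].
  have [a Aa] : exists a, A = mx a.
    exists [ffun ij => inord `|A ij.1 ij.2 + B%:Z|]; apply/matrixP => i j.
    have := Ab i j; rewrite !mxE ffunE /= => Aij.
    rewrite inordK; [lia|lia].
  rewrite Aa in fr.
  exists (existT _ a (finset (fun z : denominator_box (mx a) => 
    `[< carrier Gam (box_point G c z) >]))); exists G, c.
  by split => //= z; rewrite inE; split => [?|/asboolP//]; apply/asboolP.
move=> Gam Gam' i _ _ [G [c [fr Gz]]] [G' [c' [fr' Gz']]].
by apply: (diffeo_class_frame fr fr') => z; rewrite Gz Gz'.
Qed.

End finiteness.

(** * Left invariant metrics *)

Section euclidean.
Context (R : realType).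

Definition dot m (u v : 'rV[R]_m) : R := (u *m v^T) ord0 ord0.

Lemma dotE m (u v : 'rV[R]_m) : dot u v = \sum_i u ord0 i * v ord0 i.
Proof. by rewrite /dot mxE; apply: eq_bigr => i _; rewrite mxE. Qed.

Lemma dotC m (u v : 'rV[R]_m) : dot u v = dot v u.
Proof. by rewrite !dotE; apply: eq_bigr => i _; rewrite mulrC. Qed.

Lemma dotDl m (u u' v : 'rV[R]_m) : dot (u + u') v = dot u v + dot u' v.
Proof. by rewrite /dot mulmxDl mxE. Qed.

Lemma dotZl m a (u v : 'rV[R]_m) : dot (a *: u) v = a * dot u v.
Proof. by rewrite /dot -scalemxAl mxE. Qed.

Lemma dotNl m (u v : 'rV[R]_m) : dot (- u) v = - dot u v.
Proof. by rewrite -scaleN1r dotZl mulN1r. Qed.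

Lemma dotDr m (u v v' : 'rV[R]_m) : dot u (v + v') = dot u v + dot u v'.
Proof. by rewrite ![dot u _]dotC dotDl. Qed.

Lemma dotZr m a (u v : 'rV[R]_m) : dot u (a *: v) = a * dot u v.
Proof. by rewrite ![dot u _]dotC dotZl. Qed.

Lemma dotNr m (u v : 'rV[R]_m) : dot u (- v) = - dot u v.
Proof. by rewrite ![dot u _]dotC dotNl. Qed.

Lemma dot_ge0 m (u : 'rV[R]_m) : 0 <= dot u u.
Proof. by rewrite dotE; apply: sumr_ge0 => i _; rewrite -expr2 sqr_ge0. Qed.

Lemma dot_eq0 m (u : 'rV[R]_m) : (dot u u == 0) = (u == 0).
Proof.
apply/idP/eqP => [|->]; last by rewrite /dot mul0mx mxE.
rewrite dotE psumr_eq0 => [/allP u0|i _]; last by rewrite -expr2 sqr_ge0.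
apply/rowP => i; rewrite mxE; have := u0 i (mem_index_enum _).
by rewrite /= -expr2 sqrf_eq0 => /eqP.
Qed.

Lemma dot_coord m (u : 'rV[R]_m) i : u ord0 i ^+ 2 <= dot u u.
Proof.
rewrite dotE (bigD1 i)//= -expr2 lerDl sumr_ge0// => j _.
by rewrite -expr2 sqr_ge0.
Qed.

Lemma cauchy_schwarz m (u v : 'rV[R]_m) : dot u v ^+ 2 <= dot u u * dot v v.
Proof.
have [->|v0] := eqVneq v 0; first by rewrite {1}/dot linear0 mulmx0 mxE expr0n mulr_ge0 ?dot_ge0.
have vv : 0 < dot v v by rewrite lt_neqAle dot_ge0 eq_sym dot_eq0 v0.
have := dot_ge0 (u - (dot u v / dot v v) *: v).
rewrite !(dotDl, dotDr, dotNl, dotNr, dotZl, dotZr) (dotC v u).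
rewrite (_ : _ + _ = (dot u u * dot v v - dot u v ^+ 2) / dot v v); last first.
  by field; rewrite gt_eqF.
by rewrite pmulr_lge0 ?invr_gt0// subr_ge0.
Qed.

Lemma dot_split m p (u : 'rV[R]_(m + p)) :
  dot u u = dot (lsubmx u) (lsubmx u) + dot (rsubmx u) (rsubmx u).
Proof. by rewrite -{1 2}[u]hsubmxK /dot tr_row_mx mul_row_col mxE. Qed.

(** For an upper triangular factor the recursion starts from the lower right block: its factor [L']
    determines the rest [r] of the first row, and the first diagonal entry is the square root of the
    Schur complement [a]. *)
Lemma cholesky m (G : 'M[R]_m) : G^T = G ->
  (forall u : 'rV_m, u != 0 -> 0 < (u *m G *m u^T) ord0 ord0) ->
  exists2 L, upper_triangular L & G = L *m L^T.
Proof.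
elim: m G => [|m IH] G GT Gpos.
  by exists 1%:M; [split=> -[]|apply/matrixP => -[]].
pose G1 : 'M[R]_(1 + m) := G.
have G1T : G1^T = G1 by [].
have G1E : G1 = block_mx (ulsubmx G1) (ursubmx G1) (ursubmx G1)^T (drsubmx G1).
  by rewrite trmx_ursub G1T submxK.
have drT : (drsubmx G1)^T = drsubmx G1 by rewrite trmx_drsub G1T.
have G1Q (x : 'rV_1) (w : 'rV_m) : row_mx x w *m G1 *m (row_mx x w)^T =
    (x *m ulsubmx G1 + w *m (ursubmx G1)^T) *m x^T +
    (x *m ursubmx G1 + w *m drsubmx G1) *m w^T.
  by rewrite {1}G1E mul_row_block tr_row_mx mul_row_col.
have drpos (u : 'rV_m) : u != 0 -> 0 < (u *m drsubmx G1 *m u^T) ord0 ord0.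
  move=> u0; have := Gpos (row_mx (0 : 'rV_1) u).
  rewrite -[G]/G1 G1Q !mul0mx trmx0 mulmx0 !add0r; apply.
  by apply: contraNneq u0 => /(congr1 (@rsubmx _ 1 1 m)); rewrite row_mxKr linear0 => ->.
have [L' L'tr drE] := IH _ drT drpos.
have L'u : L' \in unitmx.
  by rewrite unitmxE upper_triangular_det// unitfE gt_eqF// prodr_gt0// => i _; case: L'tr.
pose r := ursubmx G1 *m invmx L'^T.
have rE : ursubmx G1 = r *m L'^T by rewrite /r mulmxKV// unitmx_tr.
pose a := G1 ord0 ord0 - dot r r.
have ulE : ulsubmx G1 = (a + dot r r)%:M.
  by rewrite [LHS]mx11_scalar !mxE subrK; congr (G1 _ _)%:M; apply/val_inj.
have a0 : 0 < a.
  (* The vector [(1, w)] minimises the quadratic form among vectors with first coordinate 1, and the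
     minimum is [a]. *)
  pose w := - (r *m invmx L').
  have := Gpos (row_mx (1%:M : 'rV_1) w).
  rewrite -[G]/G1 G1Q !mul1mx trmx1 mulmx1.
  have wL : w *m L' = - r by rewrite /w mulNmx mulmxKV.
  rewrite rE trmx_mul trmxK drE !mulmxA wL !mulNmx subrr mul0mx addr0.
  rewrite ulE mxE [_%:M _ _]mxE eqxx mulr1n.
  rewrite [X in _ < _ + X](_ : _ = - dot r r); last first.
    by rewrite mxE.
  rewrite addrK; apply; apply/eqP => /(congr1 (@lsubmx _ 1 1 m)); rewrite row_mxKl linear0.
  by move=> /rowP/(_ ord0); rewrite !mxE => /eqP; rewrite oner_eq0.
pose s := Num.sqrt a.
have s0 : 0 < s by rewrite sqrtr_gt0.
exists (block_mx s%:M r 0 L' : 'M[R]_(1 + m)).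
  split=> [i j|i].
    case: (@split_ordP 1 m i) => i' ->; case: (@split_ordP 1 m j) => j' -> ij.
    - by rewrite !ord1 ltnn in ij.
    - by move: ij; rewrite ord1 /= ltn0.
    - by rewrite (@block_mxEdl _ 1 m 1 m) mxE.
    - by rewrite (@block_mxEdr _ 1 m 1 m); case: L'tr => + _; apply;
        rewrite /= !add1n ltnS in ij.
  case: (@split_ordP 1 m i) => i' ->; rewrite ?(@block_mxEul _ 1 m 1 m) ?(@block_mxEdr _ 1 m 1 m) ?ord1.
    by rewrite mxE eqxx.
  by case: L'tr.
rewrite -[G]/G1 G1E [in RHS](@tr_block_mx _ 1 m 1 m) [RHS](@mulmx_block _ 1 m 1 m 1 m).
have -> : ulsubmx G1 = s%:M *m (s%:M)^T + r *m r^T.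
  rewrite ulE tr_scalar_mx -scalar_mxM -expr2 sqr_sqrtr ?ltW// raddfD /=; congr (_ + _).
  by rewrite [RHS]mx11_scalar.
have -> : (ursubmx G1)^T = L' *m r^T by rewrite rE trmx_mul trmxK.
by rewrite trmx0 [in RHS]mulmx0 !mul0mx !add0r -drE -rE.
Qed.

End euclidean.

Section left_invariant_metrics.
Context (R : realType) (n : nat).
Local Notation H := (heis R n).

(** The linear part of left translation by [h], which is an affine map; it acts on row vectors from
    the right. *)
Definition translation_mx (h : H) : 'M[R]_(n + n + 1) :=
  1%:M + (\col_i (2^-1 * symp h (delta_mx 0 i))) *m central n 1.

Lemma translation_mxE (h u : H) :
  u *m translation_mx h = u + central n (2^-1 * symp h u).
Proof.
rewrite /translation_mx mulmxDr mulmx1; congr (_ + _).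
rewrite mulmxA -[in RHS](mulr1 (_ * symp h u)) centralZ -mul_scalar_mx.
congr (_ *m _); rewrite [LHS]mx11_scalar mxE; congr (_%:M).
rewrite {2}(matrix_sum_delta u) big_ord1 linear_sum mulr_sumr; apply: eq_bigr => i _.
by rewrite mxE linearZ /= mulrCA.
Qed.

Lemma hmul_translation (h p : H) : hmul h p = h + p *m translation_mx h.
Proof. by rewrite translation_mxE addrA. Qed.

Lemma diff_hmul (h p u : H) : 'd (hmul h) p u = u *m translation_mx h.
Proof.
have -> : hmul h = cst h + mulmxr (translation_mx h).
  by apply/funext => q /=; rewrite hmul_translation.
have lc := @mulmxr_continuous R _ _ (translation_mx h).
have dc : differentiable (cst h : H -> H) p by exact: differentiable_cst.
have dl : differentiable (mulmxr (translation_mx h) : H -> H) p.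
  exact: (@linear_differentiable _ _ _ (mulmxr (translation_mx h)) p lc).
have E0 : ('d (cst h : H -> H) p : H -> H) = 0 by exact: diff_cst.
have El : ('d (mulmxr (translation_mx h)) p : H -> H) = mulmxr (translation_mx h).
  exact: diff_lin lc.
apply: etrans (congr1 (fun F : H -> H => F u) (diffD dc dl)) _.
by apply: etrans (f_equal2 +%R (congr1 (fun F : H -> H => F u) E0)
  (congr1 (fun F : H -> H => F u) El)) _; exact: add0r.
Qed.

Lemma translation_mxN (h : H) : translation_mx (- h) *m translation_mx h = 1%:M.
Proof.
apply/row_matrixP => i; rewrite !rowE mulmxA mulmx1 !translation_mxE.
rewrite symp_oppl symp_addr symp_centralr addr0 mulrN centralN subrK//.
Qed.

Lemma delta_mx_central : delta_mx 0 (rshift (n + n) 0) = central n 1 :> H.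
Proof.
by apply/rowP => l; rewrite !mxE; case: (split_ordP l) => l' ->;
  rewrite ?ord1 ?eq_rshift ?eq_lrshift !mxE /=.
Qed.

Lemma inner_ext m (A B : 'M[R]_m) :
  (forall u v : 'rV_m, (u *m A *m v^T) ord0 ord0 = (u *m B *m v^T) ord0 ord0) -> A = B.
Proof.
move=> AB; apply/matrixP => i j; have := AB (delta_mx 0 i) (delta_mx 0 j).
by rewrite !trmx_delta -!rowE -!colE !mxE.
Qed.

Variables (g : H -> 'M[R]_(n + n + 1)).
Hypothesis gl : left_invariant g.

Lemma left_invariant_gram p :
  g p = translation_mx (- p) *m g 0 *m (translation_mx (- p))^T.
Proof.
apply: inner_ext => u v.
have := gl p 0 (u *m translation_mx (- p)) (v *m translation_mx (- p)).
have TK (w : H) : w *m translation_mx (- p) *m translation_mx p = w.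
  by rewrite -mulmxA translation_mxN mulmx1.
by rewrite !diff_hmul hmulp0 !TK /inner => ->; rewrite trmx_mul !mulmxA.
Qed.

Lemma translation_mx_lower (h : H) (i j : 'I_(n + n + 1)) : (j <= i)%N ->
  translation_mx h i j = (i == j)%:R.
Proof.
move=> ji; rewrite /translation_mx !mxE big_ord1 !mxE.
case: (split_ordP j) ji => j' -> ji; rewrite /central ?row_mxEl ?row_mxEr ?mxE ?mulr0 ?addr0//.
have -> : i = rshift (n + n) 0.
  by apply/val_inj => /=; move: ji (ltn_ord i); rewrite ord1 /=; lia.
by rewrite delta_mx_central symp_centralr mulr0 mul0r addr0.
Qed.

Lemma translation_mx_triangular (h : H) : upper_triangular (translation_mx h).
Proof.
split=> [i j ij|i]; rewrite translation_mx_lower ?eqxx ?ltr01// 1?ltnW//.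
by case: eqP ij => // ->; rewrite ltnn.
Qed.

Lemma det_translation_mx (h : H) : \det (translation_mx h) = 1.
Proof.
rewrite upper_triangular_det; last exact: translation_mx_triangular.
by rewrite big1// => i _; rewrite translation_mx_lower ?eqxx.
Qed.

Lemma det_left_invariant p : \det (g p) = \det (g 0).
Proof.
by rewrite left_invariant_gram !det_mulmx det_tr !det_translation_mx mul1r mulr1.
Qed.

End left_invariant_metrics.

Section horizontal_part.
Context (R : realType) (n : nat).
Local Notation H := (heis R n).
Variables (L : 'M[R]_(n + n + 1)).
Hypothesis Ltr : upper_triangular L.

(* With respect to the Gram matrix L *m L^T, the part of u orthogonal to the
   centre, in an orthonormal basis. *)
Definition hor (u : H) : 'rV[R]_(n + n) := lsubmx (u *m L).

(* The length of the central vector (0, 1). *)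
Definition central_length : R := drsubmx L ord0 ord0.

Lemma upper_triangular_blockE :
  L = block_mx (ulsubmx L) (ursubmx L) 0 central_length%:M.
Proof.
rewrite -{1}[L]submxK /central_length -mx11_scalar; congr block_mx.
by apply/matrixP => i j; rewrite !mxE; case: Ltr => + _; apply; have := ltn_ord j; rewrite /=; lia.
Qed.

Lemma horE u : hor u = lsubmx u *m ulsubmx L.
Proof.
rewrite /hor -{1}[u]hsubmxK {1}upper_triangular_blockE mul_row_block mulmx0 addr0.
by rewrite row_mxKl.
Qed.

Lemma horD u v : hor (u + v) = hor u + hor v.
Proof. by rewrite /hor mulmxDl linearD. Qed.

Lemma horN u : hor (- u) = - hor u.
Proof. by rewrite /hor mulNmx linearN. Qed.

Lemma hor_central z : hor (central n z) = 0.
Proof. by rewrite horE /central row_mxKl mul0mx. Qed.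

Lemma hor_hmul p q : hor (hmul p q) = hor p + hor q.
Proof. by rewrite /hmul !horD hor_central addr0. Qed.

Lemma central_mulL z : central n z *m L = central n (z * central_length).
Proof.
rewrite {1}upper_triangular_blockE /central mul_row_block !mul0mx mulmx0 !add0r.
by congr row_mx; apply/rowP => i; rewrite !mxE big_ord1 !mxE !ord1 eqxx mulr1n.
Qed.

Lemma central_length_gt0 : 0 < central_length.
Proof. by rewrite /central_length !mxE; case: Ltr. Qed.

Lemma upper_triangular_unit m (U : 'M[R]_m) : upper_triangular U -> U \in unitmx.
Proof.
move=> Utr; rewrite unitmxE upper_triangular_det// unitfE gt_eqF// prodr_gt0// => i _.
by case: Utr.
Qed.

Lemma hor_surj x : exists u, hor u = x /\ rsubmx (u *m L) = 0.
Proof.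
exists (row_mx x 0 *m invmx L).
by rewrite /hor mulmxKV ?upper_triangular_unit// row_mxKl row_mxKr.
Qed.

(** [rsubmx (u *m L) = 0] expresses that [u] is orthogonal to the centre. A central correction
    achieves this without affecting the symplectic form, and so gives access to the Ricci
    formula. *)
Lemma hor_lift (p : H) : exists u, [/\ hor u = hor p, rsubmx (u *m L) = 0 &
  exists z, u = p + central n z].
Proof.
exists (p - central n (rsubmx (p *m L) ord0 ord0 / central_length)); split.
- by rewrite horD horN hor_central subr0.
- rewrite mulmxBl central_mulL divfK ?gt_eqF ?central_length_gt0// linearB /=.
  by rewrite row_mxKr; apply/rowP => i; rewrite !mxE !ord1 subrr.
- by eexists; rewrite -centralN.
Qed.

Variable g : H -> 'M[R]_(n + n + 1).
Hypothesis gl : left_invariant g.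
Hypothesis gL : g 0 = L *m L^T.

Lemma inner_dot p u v :
  inner g p u v = dot (u *m translation_mx (- p) *m L) (v *m translation_mx (- p) *m L).
Proof.
rewrite /inner /dot (left_invariant_gram gl) gL !trmx_mul.
by rewrite !mulmxA.
Qed.

Lemma hor_translation p u : hor (u *m translation_mx p) = hor u.
Proof. by rewrite translation_mxE horD hor_central addr0. Qed.

(** The projection to C^n does not increase lengths: it drops one orthonormal coordinate, and left
    translations preserve [hor]. *)
Lemma hor_le_inner p u : dot (hor u) (hor u) <= inner g p u u.
Proof.
rewrite -(hor_translation (- p) u) inner_dot [leRHS]dot_split /hor lerDl.
exact: dot_ge0.
Qed.

End horizontal_part.

(** * Ricci curvature of a left invariant metric *)

(** The Gram matrix and the Christoffel symbols are polynomials of degree at most two along every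
    line, so their derivatives can be read off as linear coefficients. *)
Lemma derive_quadratic (R : realType) (V : normedModType R) (f : V -> R^o)
    (p v : V) (c d : R) :
  (forall h : R, f (h *: v + p) = f p + h * c + h ^+ 2 * d) -> 'D_v f p = c.
Proof.
move=> fE.
have H : (fun h : R => h^-1 *: ((f \o shift p) (h *: v) - f p)) @ 0^' --> (c : R^o).
  have -> : c = c + 0 * d by rewrite mul0r addr0.
  apply: (@cvg_trans _ ((fun h : R => c + h * d : R^o) @ 0^')).
    apply: near_eq_cvg; near=> h => /=.
    have h0 : h != 0 by near: h; exact: nbhs_dnbhs_neq.
    by rewrite fE [RHS]/GRing.scale /=; field.
  apply: cvgD; first exact: cvg_cst.
  apply: cvgM; last exact: cvg_cst.
  exact: cvg_within.
exact: cvg_lim.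
Unshelve. all: by end_near. Qed.

Section ricci_left_invariant.
Context (R : realType) (n : nat).
Local Notation H := (heis R n).
Local Notation I := 'I_(n + n + 1).
Implicit Types (i j k l r : I).
Variables (g : H -> 'M[R]_(n + n + 1)).
Hypothesis gl : left_invariant g.
Hypothesis gT : (g 0)^T = g 0.
Hypothesis gU : g 0 \in unitmx.

Let z : I := rshift (n + n) 0.
Let e i : H := delta_mx 0 i.
Let om i j : R := symp (e i) (e j).
Let G := g 0.

Let ezE : e z = central n 1. Proof. exact: delta_mx_central. Qed.

Let om_zr i : om i z = 0. Proof. by rewrite /om ezE symp_centralr. Qed.
Let om_zl i : om z i = 0. Proof. by rewrite /om ezE symp_centrall. Qed.
Let omC i j : om i j = - om j i. Proof. exact: sympC. Qed.

Let translationE p i j :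
  translation_mx p i j = (i == j)%:R + 2^-1 * symp p (e i) * (j == z)%:R.
Proof. by rewrite /translation_mx -ezE !mxE big_ord1 !mxE eqxx. Qed.

Let sum_delta i (F : I -> R) : \sum_l (l == i)%:R * F l = F i.
Proof.
rewrite (bigD1 i)//= eqxx mul1r big1 ?addr0// => j /negbTE ->.
by rewrite mul0r.
Qed.

Let gramE p i j : g p i j = G i j - 2^-1 * symp p (e i) * G z j
  - 2^-1 * symp p (e j) * G i z + 4^-1 * (symp p (e i) * symp p (e j)) * G z z.
Proof.
have E (M : 'M[R]_(n + n + 1)) a b :
    (translation_mx (- p) *m M) a b = M a b - 2^-1 * symp p (e a) * M z b.
  rewrite mxE -(sum_delta a (M^~ b)) -(sum_delta z (M^~ b)) mulr_sumr -sumrB.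
  by apply: eq_bigr => l _; rewrite translationE symp_oppl (eq_sym a); ring.
have trE (M : 'M[R]_(n + n + 1)) a b : M^T a b = M b a by rewrite mxE.
rewrite (left_invariant_gram gl) -/G -[_ *m _^T]trmxK trmx_mul trmxK trE E !trE !E.
by field.
Qed.

(** The one-form dual to the central field: the inner product of the coordinate fields with it. *)
Let th p i := g p i z.

Let thE p i : th p i = G i z - 2^-1 * symp p (e i) * G z z.
Proof. by rewrite /th gramE ezE symp_centralr; ring. Qed.

Let partial_gram i j l p :
  partial i (fun q => g q j l) p = - 2^-1 * (om i j * th p l + om i l * th p j).
Proof.
have Gz a : G z a = G a z by rewrite /G -{1}gT mxE.
apply: (@derive_quadratic R H (fun q => g q j l) p (e i) _
  (4^-1 * (om i j * om i l) * G z z)).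
by move=> h; rewrite (gramE (h *: e i + p)) (gramE p) (thE p l) (thE p j) !symp_addl
  !symp_scalel -/(om i j) -/(om i l) (Gz l); field.
Qed.

(* Both th and raised are affine in p, so that the Christoffel symbols are
   quadratic. *)
Let raised p k i := \sum_l invmx (g p) k l * om i l.

Let christoffelE k i j p :
  christoffel g k i j p = - 2^-1 * (raised p k i * th p j + raised p k j * th p i).
Proof.
rewrite /christoffel /raised !mulr_suml -big_split !mulr_sumr /=.
by apply: eq_bigr => l _; rewrite !partial_gram (omC j i) (omC l i) (omC l j); field.
Qed.

Let raised0 k i := \sum_l invmx G k l * om i l.

(** With [T = translation_mx p], the inverse Gram matrix at [p] is [T^T *m invmx G *m T]. The factor
    [T] fixes the column [om i], which vanishes on the centre, and [T^T] alters the central entry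
    only. *)
Let raisedE p k i : raised p k i =
  raised0 k i + (k == z)%:R * (2^-1 * \sum_b symp p (e b) * raised0 b i).
Proof.
have TT : translation_mx p *m translation_mx (- p) = 1%:M.
  by have := translation_mxN (- p); rewrite opprK.
have inv_gram : invmx (g p) = (translation_mx p)^T *m invmx G *m translation_mx p.
  have gX : g p *m ((translation_mx p)^T *m invmx G *m translation_mx p) = 1%:M.
    rewrite (left_invariant_gram gl) -/G !mulmxA -[_ *m _^T *m _^T]mulmxA -trmx_mul TT.
    by rewrite trmx1 mulmx1 mulmxK// translation_mxN.
  have [gu _] := mulmx1_unit gX.
  by rewrite -[RHS](mulKmx gu) gX mulmx1.
pose W : 'cV[R]_(n + n + 1) := \col_l om i l.
have TW : translation_mx p *m W = W.
  apply/colP => a; rewrite !mxE -[RHS](sum_delta a (om i)); apply: eq_bigr => l _.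
  rewrite translationE mxE (eq_sym a) mulrDl -[RHS]addr0; congr (_ + _).
  by case: eqP => [->|_]; rewrite ?om_zr !mulr0 ?mul0r.
have -> : raised p k i = (invmx (g p) *m W) k 0.
  by rewrite mxE; apply: eq_bigr => l _; rewrite mxE.
rewrite inv_gram -[_ *m W]mulmxA TW -mulmxA mxE -(sum_delta k (raised0^~ i)) !mulr_sumr -big_split.
apply: eq_bigr => b _ /=; rewrite [_^T _ _]mxE translationE.
rewrite (_ : (invmx G *m W) b 0 = raised0 b i); first by rewrite (eq_sym k); ring.
by rewrite mxE; apply: eq_bigr => l _; rewrite mxE.
Qed.

(** The inner product of the covectors [om i] and [om j] for the inverse metric at 0. *)
Let S i j := \sum_b om i b * raised0 b j.

Let partial_christoffel0 l i j k : partial l (christoffel g k i j) 0 =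
  - 2^-1 * ((k == z)%:R * 2^-1 * S l i * th 0 j - 2^-1 * raised0 k i * om l j * G z z
          + (k == z)%:R * 2^-1 * S l j * th 0 i - 2^-1 * raised0 k j * om l i * G z z).
Proof.
pose s i := (k == z)%:R * (2^-1 * S l i).
pose t i := - (2^-1 * om l i * G z z).
have sE (h : R) i' : raised (h *: e l + 0) k i' = raised0 k i' + h * s i'.
  rewrite raisedE /s (_ : \sum_b _ = h * S l i'); first by ring.
  by rewrite mulr_sumr; apply: eq_bigr => b _; rewrite addr0 symp_scalel mulrA.
have tE (h : R) i' : th (h *: e l + 0) i' = th 0 i' + h * t i'.
  rewrite (thE (h *: e l + 0)) (thE 0) addr0 symp_scalel -/(om l i').
  by rewrite symp_0l /t; ring.
have s0 i' : raised 0 k i' = raised0 k i'.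
  by have := sE 0 i'; rewrite scale0r addr0 mul0r addr0.
apply: (@derive_quadratic R H (christoffel g k i j) 0 (e l) _
  (- 2^-1 * (s i * t j + s j * t i))).
by move=> h; rewrite !christoffelE !sE !tE !s0 /s /t; field.
Qed.

Let Gi i j := invmx G i j.

Let GiC i j : Gi i j = Gi j i.
Proof. by rewrite /Gi -{1}[G]gT -trmx_inv mxE. Qed.

Let S_sym i j : S i j = S j i.
Proof.
rewrite /S /raised0; under eq_bigr => b _ do rewrite mulr_sumr.
rewrite exchange_big; apply: eq_bigr => a _; rewrite mulr_sumr; apply: eq_bigr => b _ /=.
by rewrite -!/(Gi _ _) GiC; ring.
Qed.

Let S_zl j : S z j = 0.
Proof. by rewrite /S big1// => b _; rewrite om_zl mul0r. Qed.

Let S_zr j : S j z = 0. Proof. by rewrite S_sym S_zl. Qed.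

Let raised0_tr : \sum_i raised0 i i = 0.
Proof.
set x := LHS; suff : x = - x by lra.
rewrite {1}/x /raised0 exchange_big -sumrN; apply: eq_bigr => l _ /=.
rewrite -sumrN; apply: eq_bigr => i _.
by rewrite -!/(Gi _ _) GiC omC mulrN.
Qed.

(** The vector [raised0 ^~ j] is orthogonal to the centre, since the covector [om j] that it
    represents vanishes there. *)
Let th_raised0 j : \sum_i th 0 i * raised0 i j = 0.
Proof.
under eq_bigr => i _ do rewrite mulr_sumr.
rewrite exchange_big; transitivity (\sum_l (l == z)%:R * om j l); last by rewrite sum_delta om_zr.
apply: eq_bigr => l _; under eq_bigr => i _ do rewrite mulrA.
rewrite -mulr_suml; congr (_ * _).
have := mulmxV gU; move=> /(congr1 (fun M : 'M[R]_(n + n + 1) => M z l)); rewrite !mxE eq_sym => <-.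
by apply: eq_bigr => i _; congr (_ * _); rewrite /th -{1}gT mxE.
Qed.

Let om_raised0 i j : \sum_b raised0 b j * om b i = - S i j.
Proof. by rewrite /S -sumrN; apply: eq_bigr => b _; rewrite omC; ring. Qed.

Let raised00 k i : raised 0 k i = raised0 k i.
Proof.
rewrite raisedE big1 ?mulr0 ?addr0// => b _.
by rewrite symp_0l mul0r.
Qed.

Let sum4 (a b c d : R) (A B C D : I -> R) :
  \sum_i (a * A i + b * B i + c * C i + d * D i) =
  a * \sum_i A i + b * \sum_i B i + c * \sum_i C i + d * \sum_i D i.
Proof. by rewrite !big_split /= !mulr_sumr. Qed.

(** [trace1] to [trace4] contract the four terms of [curvature]. Skew-symmetry of [om] and
    orthogonality to the centre remove most summands. *)
Let trace1 j k :
  \sum_i partial i (christoffel g i j k) 0 = - 2^-1 * S j k * G z z.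
Proof.
transitivity (\sum_i (- 4^-1 * th 0 k * ((i == z)%:R * S i j)
    + 4^-1 * G z z * (raised0 i j * om i k)
    + - 4^-1 * th 0 j * ((i == z)%:R * S i k)
    + 4^-1 * G z z * (raised0 i k * om i j))).
  by apply: eq_bigr => i _; rewrite partial_christoffel0; field.
by rewrite sum4 !sum_delta !S_zl !om_raised0 (S_sym k j); field.
Qed.

Let trace2 j k : \sum_i partial j (christoffel g i i k) 0 = 0.
Proof.
transitivity (\sum_i (- 4^-1 * th 0 k * ((i == z)%:R * S j i)
    + 4^-1 * om j k * G z z * raised0 i i
    + - 4^-1 * S j k * ((i == z)%:R * th 0 i)
    + - 4^-1 * G z z * (raised0 i k * om i j))).
  by apply: eq_bigr => i _; rewrite partial_christoffel0 (omC j i); field.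
rewrite sum4 !sum_delta S_zr raised0_tr om_raised0.
rewrite (_ : th 0 z = G z z)//; ring.
Qed.

Let trace3 j k :
  \sum_i \sum_r christoffel g i i r 0 * christoffel g r j k 0 = 0.
Proof.
rewrite exchange_big big1// => r _ /=; rewrite -mulr_suml.
rewrite (_ : \sum_i _ = 0) ?mul0r//.
under eq_bigr => i _ do rewrite christoffelE !raised00 (mulrC (raised0 i r)).
by rewrite -mulr_sumr big_split /= -mulr_suml raised0_tr th_raised0 mul0r addr0 mulr0.
Qed.

Let trace4 j k :
  \sum_i \sum_r christoffel g i j r 0 * christoffel g r i k 0 =
  4^-1 * (\sum_i \sum_r raised0 i r * raised0 r i) * (th 0 j * th 0 k).
Proof.
transitivity (\sum_i ((4^-1 * th 0 k * raised0 i j) * (\sum_r th 0 r * raised0 r i)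
   + (4^-1 * th 0 i * raised0 i j) * (\sum_r th 0 r * raised0 r k)
   + (4^-1 * th 0 j * th 0 k) * (\sum_r raised0 i r * raised0 r i)
   + (4^-1 * th 0 j) * \sum_r raised0 i r * (th 0 i * raised0 r k))).
  apply: eq_bigr => i _; rewrite -sum4; apply: eq_bigr => r _.
  by rewrite !christoffelE !raised00; field.
under eq_bigr => i _ do rewrite !th_raised0 !mulr0 !add0r.
rewrite big_split /= -!mulr_sumr [X in _ + _ * X]exchange_big /=.
rewrite [X in _ + _ * X]big1 ?mulr0 ?addr0; first by ring.
move=> r _; under eq_bigr => i _ do rewrite mulrCA mulrA.
by rewrite -mulr_suml th_raised0 mul0r.
Qed.

(** The second term vanishes on vectors orthogonal to the centre, so its coefficient may stay
    unspecified. *)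
Let ricci_trace : exists c, forall j k,
  \sum_i curvature g i i j k 0 = - 2^-1 * S j k * G z z - c * (th 0 j * th 0 k).
Proof.
exists (4^-1 * \sum_i \sum_r raised0 i r * raised0 r i) => j k.
transitivity (\sum_i partial i (christoffel g i j k) 0
    - \sum_i partial j (christoffel g i i k) 0
    + (\sum_i \sum_r christoffel g i i r 0 * christoffel g r j k 0
       - \sum_i \sum_r christoffel g i j r 0 * christoffel g r i k 0)).
  rewrite -!sumrB -big_split; apply: eq_bigr => i _ /=.
  by rewrite -sumrB.
apply: etrans (f_equal2 +%R (f_equal2 (fun a b => a - b) (trace1 j k) (trace2 j k))
  (f_equal2 (fun a b => a - b) (trace3 j k) (trace4 j k))) _.
by rewrite subr0 sub0r.
Qed.

(** The hypothesis is orthogonality to the centre, and the double sum is the squared norm of the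
    covector [symp u]. *)
Lemma ricci_horizontal (u : H) : (\sum_i u ord0 i * g 0 i z = 0) ->
  ricci g 0 u u = - 2^-1 * g 0 z z *
    \sum_i \sum_j symp u (e i) * invmx (g 0) i j * symp u (e j).
Proof.
move=> uth; have [c tr] := ricci_trace.
have sympE b : symp u (e b) = \sum_j u ord0 j * om j b.
  rewrite {1}(row_sum_delta u) symp_suml; apply: eq_bigr => j _.
  by rewrite symp_scalel.
have raise b : \sum_k u ord0 k * raised0 b k = \sum_l invmx G b l * symp u (e l).
  under eq_bigr => k _ do rewrite mulr_sumr.
  rewrite exchange_big; apply: eq_bigr => l _; rewrite sympE mulr_sumr.
  by apply: eq_bigr => k _; rewrite /=; ring.
have SE : \sum_j \sum_k u ord0 j * u ord0 k * S j k =
    \sum_i \sum_j symp u (e i) * invmx G i j * symp u (e j).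
  transitivity (\sum_b symp u (e b) * \sum_k u ord0 k * raised0 b k); last first.
    by apply: eq_bigr => b _; rewrite raise mulr_sumr; apply: eq_bigr => l _; rewrite mulrA.
  under [RHS]eq_bigr => b _ do rewrite sympE mulr_suml.
  rewrite [RHS]exchange_big; apply: eq_bigr => j _ /=.
  under [RHS]eq_bigr => b _ do rewrite mulr_sumr.
  rewrite [RHS]exchange_big; apply: eq_bigr => k _ /=; rewrite /S mulr_sumr.
  by apply: eq_bigr => b _; ring.
transitivity (- 2^-1 * G z z * (\sum_j \sum_k u ord0 j * u ord0 k * S j k)
    - c * ((\sum_j u ord0 j * th 0 j) * (\sum_k u ord0 k * th 0 k))).
  rewrite big_distrlr /= !mulr_sumr -sumrB; apply: eq_bigr => j _.
  by rewrite !mulr_sumr -sumrB; apply: eq_bigr => k _; rewrite tr; ring.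
by rewrite uth mul0r mulr0 subr0 SE.
Qed.

End ricci_left_invariant.

(** * From the Ricci bound to a bound on the symplectic form *)

Section ricci_bound.
Context (R : realType) (n : nat) (K : R).
Local Notation H := (heis R n).
Variables (g : H -> 'M[R]_(n + n + 1)) (L : 'M[R]_(n + n + 1)).
Hypothesis gl : left_invariant g.
Hypothesis Ltr : upper_triangular L.
Hypothesis gL : g 0 = L *m L^T.
Hypothesis gK : ricci_ge g K.

Let z : 'I_(n + n + 1) := rshift (n + n) 0.

Let ezE : delta_mx 0 z = central n 1 :> H. Proof. exact: delta_mx_central. Qed.

Let gramE (u v : H) : (u *m g 0 *m v^T) ord0 ord0 = dot (u *m L) (v *m L).
Proof. by rewrite /dot gL trmx_mul !mulmxA. Qed.

Let g_zr (u : H) : \sum_i u ord0 i * g 0 i z = rsubmx (u *m L) ord0 ord0 * central_length L.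
Proof.
transitivity ((u *m g 0 *m (delta_mx 0 z : H)^T) ord0 ord0).
  by rewrite trmx_delta -colE !mxE; apply: eq_bigr => i _.
rewrite gramE ezE (central_mulL Ltr) mul1r /dot /central tr_row_mx.
rewrite -[u *m L]hsubmxK mul_row_col trmx0 mulmx0 add0r row_mxKr mxE big_ord1.
by rewrite trmx_const [X in _ * X]mxE.
Qed.

(** In orthonormal coordinates the covector [symp u] is [w]. The Ricci bound reads [K <= - 2^-1 *
    central_length L ^+ 2 * dot w w], and Cauchy-Schwarz passes from [w] to [symp u v]. *)
Lemma symp_horizontal_le (u v : H) : rsubmx (u *m L) = 0 ->
  dot (u *m L) (u *m L) = 1 ->
  central_length L ^+ 2 * symp u v ^+ 2 <= - 2 * K * dot (v *m L) (v *m L).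
Proof.
move=> uh u1.
have Lu : L \in unitmx by exact: upper_triangular_unit.
have gT : (g 0)^T = g 0 by rewrite gL trmx_mul trmxK.
have gU : g 0 \in unitmx by rewrite gL unitmx_mul Lu unitmx_tr.
pose s : H := \row_i symp u (delta_mx 0 i).
pose w := s *m invmx L^T.
have wE : \sum_i \sum_j symp u (delta_mx 0 i) * invmx (g 0) i j * symp u (delta_mx 0 j)
    = dot w w.
  transitivity ((s *m invmx (g 0) *m s^T) ord0 ord0).
    rewrite mxE exchange_big; apply: eq_bigr => j _ /=; rewrite mxE mulr_suml.
    by apply: eq_bigr => i _; rewrite !mxE.
  rewrite /dot /w trmx_mul -trmx_inv trmxK !mulmxA; congr ((_ *m _) _ _).
  rewrite -!mulmxA; congr (_ *m _).
  have g1 : g 0 *m ((invmx L)^T *m invmx L) = 1%:M.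
    by rewrite gL trmx_inv mulmxA mulmxK ?unitmx_tr// mulmxV.
  by rewrite -[RHS](mulKmx gU) g1 mulmx1.
have suv : symp u v = dot w (v *m L).
  rewrite /dot /w trmx_mul mulmxA mulmxKV ?unitmx_tr// mxE.
  rewrite {1}(row_sum_delta v) linear_sum; apply: eq_bigr => i _.
  by rewrite linearZ !mxE mulrC.
have gzz : g 0 z z = central_length L ^+ 2.
  have := g_zr (delta_mx 0 z); rewrite ezE (central_mulL Ltr) mul1r row_mxKr mxE -expr2 => <-.
  by rewrite -ezE (bigD1 z)//= !mxE !eqxx mul1r big1 ?addr0// => i /negbTE iz;
    rewrite mxE iz andbF mul0r.
have KR : K <= - 2^-1 * central_length L ^+ 2 * dot w w.
  rewrite -wE -gzz -ricci_horizontal//; last by rewrite g_zr uh mxE mul0r.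
  by apply: gK; rewrite /inner gramE.
have w2 := dot_ge0 w; have v2 := dot_ge0 (v *m L).
have := cauchy_schwarz w (v *m L); rewrite -suv => CS.
apply: (@le_trans _ _ (central_length L ^+ 2 * (dot w w * dot (v *m L) (v *m L)))).
  by rewrite ler_wpM2l// sqr_ge0.
rewrite mulrA ler_wpM2r//; lra.
Qed.

Lemma symp_hor_le (p q : H) :
  central_length L ^+ 2 * symp p q ^+ 2 <=
  - 2 * K * (dot (hor L p) (hor L p) * dot (hor L q) (hor L q)).
Proof.
have [u [up uh [zu uE]]] := hor_lift Ltr p.
have [v [vq vh [zv vE]]] := hor_lift Ltr q.
have -> : symp p q = symp u v.
  by rewrite uE vE symp_addl !symp_addr !symp_centralr symp_centrall !addr0.
have dotE (w : H) : rsubmx (w *m L) = 0 -> dot (w *m L) (w *m L) = dot (hor L w) (hor L w).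
  by move=> w0; rewrite dot_split w0 {2}/dot mul0mx mxE addr0.
rewrite -up -vq -!dotE//; set a := dot (u *m L) (u *m L).
have a0 : 0 <= a by exact: dot_ge0.
have [az|az] := eqVneq a 0.
  have /eqP u0 : u *m L == 0 by rewrite -dot_eq0 -/a az.
  have -> : u = 0.
    by rewrite -[u](mulmxK (upper_triangular_unit Ltr)) u0 mul0mx.
  by rewrite symp_0l expr0n mulr0 az mul0r mulr0.
have ap : 0 < a by rewrite lt_neqAle eq_sym az.
have := @symp_horizontal_le ((Num.sqrt a)^-1 *: u) v.
rewrite -scalemxAl linearZ /= uh scaler0 dotZl dotZr -/a => /(_ erefl).
rewrite mulrA -invfM -expr2 sqr_sqrtr// mulVf// symp_scalel
  exprMn exprVn sqr_sqrtr// => /(_ erefl).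
by rewrite mulrCA ler_pdivrMl// [_ * K * (a * _)]mulrCA.
Qed.

End ricci_bound.

(** * Diameter and volume *)

Section curve_lengths.
Context (R : realType).
Local Notation leb := (@lebesgue_measure R).

Lemma continuous_coord m (f : R -> 'rV[R]_m) i : continuous f ->
  continuous (fun t => f t ord0 i : R^o).
Proof.
move=> fc t; exact: (@continuous_comp _ _ _ f (fun v : 'rV[R]_m => v ord0 i) t (fc t)
  (@coord_continuous _ 1 m ord0 i (f t))).
Qed.

Lemma C1_curve_continuous m (c : R -> 'rV[R]_m) : C1_curve c -> continuous c.
Proof.
by move=> [cd _] t; apply: differentiable_continuous; apply/derivable1_diffP.
Qed.

Lemma C1_curve_FTC m (c : R -> 'rV[R]_m) (A : 'cV[R]_m) : C1_curve c ->
  (\int[leb]_(t in `[0%R, 1%R]) ((derive1 c t *m A) ord0 ord0)%:E =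
   ((c 1 *m A) ord0 ord0)%:E - ((c 0 *m A) ord0 ord0)%:E)%E.
Proof.
move=> cC1; have [cd cc] := cC1.
pose l (v : 'rV[R]_m) : R^o := (v *m A) ord0 ord0.
have l_lin : linear l by move=> a u v; rewrite /l mulmxDl -scalemxAl !mxE.
pose l' : {linear 'rV[R]_m -> R^o} := HB.pack l (GRing.isLinear.Build _ _ _ _ l l_lin).
have lc : continuous l'.
  move=> v; apply: (@continuous_comp _ _ _ (mulmxr A) (fun M : 'rV[R]_1 => M ord0 ord0)).
    exact: mulmxr_continuous.
  exact: coord_continuous.
have dF (t : R) : is_derive t 1 (l \o c) (l (derive1 c t)).
  have dc : differentiable c t by apply/derivable1_diffP.
  have dl : differentiable l' (c t) by exact: linear_differentiable lc.
  have dlc := differentiable_comp dc dl.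
  split; first exact: diff_derivable.
  rewrite (deriveE _ dlc) (diff_comp dc dl) /= (diff_lin _ lc) /l derive1E.
  by rewrite (deriveE _ dc).
have Fc : continuous (l \o c).
  by move=> t; apply: differentiable_continuous; apply/derivable1_diffP; case: (dF t).
have fc : continuous (l \o derive1 c).
  by move=> t; apply: continuous_comp; [exact: cc|exact: lc].
apply: (@continuous_FTC2 _ (l \o derive1 c) (l \o c)) => //.
- exact: continuous_subspaceT.
- split.
  + by move=> t _; case: (dF t).
  + exact: cvg_at_right_filter (Fc 0).
  + exact: cvg_at_left_filter (Fc 1).
- by move=> t _; rewrite derive1E; case: (dF t).
Qed.

Variables (m : nat) (g : 'rV[R]_m -> 'M[R]_m).
Hypothesis gm : riemannian_metric g.

Let speed (c : R -> 'rV[R]_m) (t : R) : R :=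
  Num.sqrt (inner g (c t) (derive1 c t) (derive1 c t)).

Lemma speed_continuous c : C1_curve c -> continuous (speed c : R -> R^o).
Proof.
move=> cC1; have [cd cc] := cC1; have [gs _ _] := gm.
have -> : speed c = (fun x => Num.sqrt x) \o (fun t => \sum_j \sum_i
    derive1 c t ord0 i * g (c t) i j * derive1 c t ord0 j).
  apply/funext => t; rewrite /speed /inner /=; congr Num.sqrt.
  rewrite mxE; apply: eq_bigr => j _; rewrite !mxE mulr_suml.
  by apply: eq_bigr => i _.
move=> t; apply: continuous_comp; last exact: sqrt_continuous.
apply: (@continuous_sum R R R^o) => j; apply: (@continuous_sum R R R^o) => i {}t.
apply: cvgM; last exact: continuous_coord.
apply: cvgM; first exact: continuous_coord.
apply: (@continuous_comp _ _ _ c (fun p => g p i j)).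
  exact: C1_curve_continuous.
have := gs i j [::] (c t); rewrite inE => /(_ I) /= dg.
exact: differentiable_continuous dg.
Qed.

(** A calibration argument: a linear functional dominated by [B] times the norm at every point grows
    along a curve by at most [B] times its length. *)
Lemma arc_length_ge c (A : 'cV[R]_m) (B : R) : C1_curve c -> 0 <= B ->
  (forall p u, (u *m A) ord0 ord0 <= B * Num.sqrt (inner g p u u)) ->
  (((c 1 *m A) ord0 ord0)%:E - ((c 0 *m A) ord0 ord0)%:E <= B%:E * arc_length g c)%E.
Proof.
move=> cC1 B0 AB; rewrite -C1_curve_FTC// /arc_length.
have cspeed : leb.-integrable `[0%R, 1%R] (EFin \o speed c).
  apply: continuous_compact_integrable; first exact: segment_compact.
  exact/continuous_subspaceT/speed_continuous.
rewrite -integralZl//.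
apply: le_integral => //.
- apply: (@continuous_compact_integrable R (fun t => (derive1 c t *m A) ord0 ord0)).
    exact: segment_compact.
  apply: continuous_subspaceT => t.
  apply: (@continuous_comp _ _ _ (mulmxr A \o derive1 c) (fun M : 'rV[R]_1 => M ord0 ord0)).
    apply: continuous_comp; last exact: mulmxr_continuous.
    by case: cC1 => _; apply.
  exact: coord_continuous.
- exact: integrableZl.
- by move=> t _; rewrite -EFinM lee_fin; exact: AB.
Qed.

Lemma curve_length_ge p cs q (A : 'cV[R]_m) (B : R) : piecewise_C1 p cs q -> 0 <= B ->
  (forall p u, (u *m A) ord0 ord0 <= B * Num.sqrt (inner g p u u)) ->
  (((q *m A) ord0 ord0)%:E - ((p *m A) ord0 ord0)%:E <= B%:E * curve_length g cs)%E.
Proof.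
move=> + B0 AB; elim: cs p => [|c cs IH] p /=.
  by move=> ->; rewrite /curve_length big_nil mule0 -EFinB subrr.
move=> [cC1 <- /IH cq]; rewrite /curve_length big_cons ge0_muleDr; first last.
- by apply: sume_ge0 => d _; apply: integral_ge0 => t _; rewrite lee_fin sqrtr_ge0.
- by apply: integral_ge0 => t _; rewrite lee_fin sqrtr_ge0.
apply: le_trans (leeD (arc_length_ge cC1 B0 AB) cq).
by rewrite -!EFinB -EFinD lee_fin; lra.
Qed.

End curve_lengths.

(** * The projected lattice is a net *)

Section net.
Context (R : realType) (n : nat) (D : R) (hD : 0 < D).
Local Notation H := (heis R n).
Variables (Gam : lattice R n) (g : H -> 'M[R]_(n + n + 1)) (L : 'M[R]_(n + n + 1)).
Hypothesis gm : riemannian_metric g.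
Hypothesis gl : left_invariant g.
Hypothesis Ltr : upper_triangular L.
Hypothesis gL : g 0 = L *m L^T.
Hypothesis gD : (quot_diam Gam g <= D%:E)%E.

(** Lift [x] to [y]. A curve in the quotient from the class of 0 to that of [y] lifts to one from
    [a] to [hmul b y] with [a], [b] in the lattice, and [hmul (- b) a] is the required element. *)
Lemma hor_net (x : 'rV[R]_(n + n)) : exists2 h, carrier Gam h &
  dot (x - hor L h) (x - hor L h) <= (D + 1) ^+ 2.
Proof.
have [y [yx _]] := hor_surj Ltr x.
have : (quot_dist g (\pi_(heis_quot Gam) (0%R : H)) (\pi_(heis_quot Gam) y) < (D + 1)%:E)%E.
  (* A strict bound is needed to extract an actual curve from the infimum, hence [D + 1]. *)
  apply: (@le_lt_trans _ _ D%:E); last by rewrite lte_fin ltrDl.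
  by apply: le_trans gD; apply: ereal_sup_ubound; do 2 eexists.
rewrite /quot_dist.
move=> /ereal_inf_lt[l [p [q [cs [/esym/eq_quotP[a Ga pE] /esym/eq_quotP[b Gb qE] pcs ->]]]]] ltD.
rewrite hmulp0 in pE; exists (hmul (- b) a).
  by apply: carrierM => //; exact: carrierN.
set w := x - _.
have wE : hor L q - hor L p = w.
  by rewrite pE qE /w !(hor_hmul Ltr) horN yx opprD opprK addrA [hor L b + x]addrC.
(* The calibrating functional is the pairing of [hor] with [w], of norm at most [B], the length of
   [w]. It grows by [B ^+ 2] along the curve, so [B] is at most [D + 1]. *)
pose A := lsubmx L *m w^T.
have hA u : (u *m A) ord0 ord0 = dot (hor L u) w.
  rewrite /dot /A mulmxA /hor; congr ((_ *m _) _ _).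
  by rewrite -{2}(hsubmxK L) mul_mx_row row_mxKl.
pose B := Num.sqrt (dot w w).
have AB p' u : (u *m A) ord0 ord0 <= B * Num.sqrt (inner g p' u u).
  rewrite hA /B -sqrtrM ?dot_ge0//.
  apply: (le_trans (ler_norm _)); rewrite -sqrtr_sqr ler_wsqrtr//.
  apply: (le_trans (cauchy_schwarz _ _)); rewrite mulrC ler_wpM2l ?dot_ge0//.
  exact: (hor_le_inner Ltr gl gL).
have := curve_length_ge gm pcs (sqrtr_ge0 _) AB; rewrite !hA -EFinB -dotNl -dotDl wE.
move=> wB; have : ((dot w w)%:E <= B%:E * (D + 1)%:E)%E.
  apply: (le_trans wB); apply: lee_wpmul2l; first by rewrite lee_fin sqrtr_ge0.
  exact: ltW.
rewrite -EFinM lee_fin -{1}[dot w w]sqr_sqrtr ?dot_ge0// -/B => BD.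
rewrite -[leLHS]sqr_sqrtr ?dot_ge0// -/B.
have B0 : 0 <= B by exact: sqrtr_ge0.
have D0 := hD; have [B1|D1] := leP B (D + 1); first by rewrite lerXn2r ?nnegrE//; lra.
have : 0 < B * (B - (D + 1)) by apply: mulr_gt0; lra.
lra.
Qed.

End net.

(** If [t *m X = 0], each [r * |t_j|] is at most [d * s] with [s] the sum of the absolute values;
    summing over [j] gives [r * s <= m * d * s] and forces [s = 0]. *)
Lemma diag_dominant_unit (R : realType) m (X : 'M[R]_m) (r d : R) : 0 <= d ->
  m%:R * d < r -> (forall i j, `|r * (i == j)%:R - X i j| <= d) -> X \in unitmx.
Proof.
move=> d0 dr Xd; rewrite -row_free_unit -kermx_eq0; apply/eqP.
apply/row_matrixP => i; rewrite row0; set t := row i _.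
have : t *m X = 0 by apply/sub_kermxP; exact: row_sub.
move: t => t tX.
pose s := \sum_j `|t ord0 j|.
have s0 : 0 <= s by apply: sumr_ge0.
have bnd j : r * `|t ord0 j| <= d * s.
  have r0 : 0 <= r by apply: ltW; apply: le_lt_trans dr; rewrite mulr_ge0.
  have -> : r * `|t ord0 j| = `|\sum_l t ord0 l * (r * (l == j)%:R - X l j)|.
    under eq_bigr => l _ do rewrite mulrBr.
    rewrite sumrB; have := congr1 (fun M : 'rV[R]_m => M ord0 j) tX.
    rewrite !mxE => ->; rewrite subr0 (@bigD1 _ _ _ _ j)//= eqxx mulr1 big1 ?addr0.
      by rewrite normrM mulrC (ger0_norm r0).
    by move=> l /negbTE ->; rewrite !mulr0.
  apply: (le_trans (ler_norm_sum _ _ _)); rewrite mulr_sumr; apply: ler_sum => l _.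
  by rewrite normrM mulrC ler_wpM2r.
have sz : s = 0.
  have : r * s <= m%:R * (d * s).
    rewrite mulr_sumr; apply: (@le_trans _ _ (\sum_(j < m) d * s)); first exact: ler_sum.
    by rewrite sumr_const card_ord mulr_natl.
  move=> rs; apply/eqP; rewrite eq_le s0 andbT leNgt; apply/negP => sp.
  by move: rs; rewrite mulrA ler_pM2r// leNgt dr.
apply/rowP => j; rewrite [RHS]mxE; apply/eqP; rewrite -normr_eq0.
by have /psumr_eq0P := sz; move=> ->.
Qed.

(** * Short lattice elements projecting to a basis *)

Section short_basis.
Context (R : realType) (n : nat) (D : R) (hD : 0 < D).
Local Notation H := (heis R n).
Variables (S : subgroup R n) (L : 'M[R]_(n + n + 1)).
Hypothesis Ltr : upper_triangular L.
Hypothesis net : forall x : 'rV[R]_(n + n), exists2 h, carrier S h &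
  dot (x - hor L h) (x - hor L h) <= D ^+ 2.

(** A bound for the squared length of a vector within [D] of one of length [(2n + 1) D], by the
    parallelogram law. *)
Definition basis_radius : R := 2 * (((n + n).+1%:R * D) ^+ 2 + D ^+ 2).

(** Take lattice elements near the multiples [r] of the unit vectors. The choice [r = (2n + 1) D]
    beats [2n] errors of size [D], so diagonal dominance gives independence. *)
Lemma short_basis : exists G : 'M[R]_(n + n, n + n + 1),
  [/\ lsubmx G \in unitmx, forall i, carrier S (row i G) &
      forall i, dot (hor L (row i G)) (hor L (row i G)) <= basis_radius].
Proof.
pose r := (n + n).+1%:R * D.
have /choice[f fP] : forall i : 'I_(n + n), exists h, carrier S h /\
    dot (r *: delta_mx 0 i - hor L h) (r *: delta_mx 0 i - hor L h) <= D ^+ 2.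
  by move=> i; have [h Sh hD2] := net (r *: delta_mx 0 i); exists h.
exists (\matrix_i f i); split.
- have : (\matrix_i hor L (f i)) \in unitmx.
    apply: (@diag_dominant_unit _ _ _ r D); first exact: ltW.
      by rewrite /r ltr_pM2r// ltr_nat.
    move=> i j; have [_ fi] := fP i.
    have := le_trans (dot_coord _ j) fi; rewrite !mxE eqxx /= (eq_sym j).
    by rewrite -real_normK ?num_real// ler_pXn2r// ?nnegrE// ltW.
  rewrite (_ : \matrix_i _ = lsubmx (\matrix_i f i) *m ulsubmx L).
    by rewrite unitmx_mul => /andP[].
  apply/row_matrixP => i; rewrite rowK (horE Ltr) row_mul; congr (_ *m _).
  by apply/rowP => j; rewrite !mxE.
- by move=> i; rewrite rowK; case: (fP i).
- move=> i; rewrite rowK; have [_ fi] := fP i.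
  set a := hor L (f i) in fi *; set b := r *: delta_mx 0 i in fi *.
  have bb : dot b b = r ^+ 2.
    rewrite /b dotZl dotZr dotE (bigD1 i)//= big1 ?addr0; first by rewrite !mxE !eqxx /=; ring.
    by move=> j /negbTE ji; rewrite mxE ji andbF mul0r.
  have := dot_ge0 (b + b - a).
  rewrite /basis_radius -/r -bb.
  move: fi; rewrite !(dotDl, dotDr, dotNl, dotNr) (dotC a b).
  lra.
Qed.

End short_basis.

(** * The centre of a lattice *)

Section centre.
Context (R : realType) (n : nat).
Variables (S : subgroup R n).
Hypothesis Sd : carrier S `<=` isolated (carrier S).

Let C z := carrier S (central n z).

Lemma centre_discrete : exists2 e, 0 < e & forall z, C z -> `|z| < e -> z = 0.
Proof.
have S0 : carrier S 0 by exact: carrier0.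
have [_ [V V0 VS]] := Sd S0.
have cc : continuous (@central R n).
  have -> : @central R n = (fun z => z *: central n 1).
    by apply/funext => z; rewrite -centralZ mulr1.
  by move=> z; exact: (@cvgZr_tmp _ _ _ (nbhs z) _ id _ _ cvg_id).
have : \forall z \near (0 : R), V (central n z).
  by have := cc 0 V; rewrite central0; apply.
move=> /nbhs_ballP[e /= e0 eV]; exists e => // z Cz ze.
have Vz : V (central n z) by apply: eV; rewrite /ball /= sub0r normrN.
have : (V `&` carrier S) (central n z) by [].
by rewrite VS /= -(central0 R n) => /central_inj.
Qed.

Lemma centre_generator z0 : C z0 -> z0 != 0 ->
  exists2 c, 0 < c & forall z, C z <-> z / c \is a Num.int.
Proof.
move=> Cz0 z00; have [e e0 eC] := centre_discrete.
have CN z : C z -> C (- z) by rewrite /C centralN; exact: carrierN.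
have CD y z : C y -> C z -> C (y + z).
  by move=> Cy Cz; have := carrierM Cy Cz; rewrite hmul_central -centralD.
pose P : set R := [set z | 0 < z /\ C z].
have P0 : P !=set0.
  exists `|z0|; split; first by rewrite normr_gt0.
  by case: (ger0P z0) => _ //; exact: CN.
have Pinf : has_inf P by split=> //; exists 0 => z [z_gt0 _]; exact: ltW.
(* An element within [e] of the infimum is the minimum: a smaller one would lie at least [e] below
   it, hence below the infimum. *)
have [c [c0 Cc] cinf] := inf_adherent e0 Pinf.
have cmin z : P z -> c <= z.
  move=> [z_gt0 Cz]; rewrite leNgt; apply/negP => zc.
  have Pcz : P (c - z) by split; [rewrite subr_gt0|apply/CD => //; exact: CN].
  have ecz : e <= c - z.
    rewrite leNgt; apply/negP => cze; have [+ /eC] := Pcz.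
    by move=> /[dup] cz0 /gtr0_norm -> /(_ cze) cz; move: cz0; rewrite cz ltxx.
  have := ge_inf Pinf.2 (conj z_gt0 Cz : P z); lra.
exists c => // z; split=> [Cz|/intrP[j zj]]; last first.
  have -> : z = j%:~R * c by rewrite -zj divfK// gt_eqF.
  by rewrite /C centralZ; apply: carrierZ => //; exact: intr_int.
have CZ (j : int) : C (j%:~R * c).
  by rewrite /C centralZ; apply: carrierZ => //; exact: intr_int.
have [fl fg] : (Num.floor (z / c))%:~R * c <= z /\ z < ((Num.floor (z / c))%:~R + 1) * c.
  split; first by rewrite -ler_pdivlMr// floor_le.
  by rewrite -ltr_pdivrMr// -(@intrD R _ 1) floorD1_gt.
have [zE|zN] := eqVneq z ((Num.floor (z / c))%:~R * c).
  by rewrite zE mulfK ?gt_eqF// intr_int.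
have : P (z - (Num.floor (z / c))%:~R * c).
  split; last by apply: CD => //; exact: CN.
  by rewrite subr_gt0 lt_neqAle eq_sym zN.
by move=> /cmin; lra.
Qed.

End centre.

(** * Volume of fundamental domains *)

Section fundamental_domains.
Context (R : realType) (n : nat).
Local Notation H := (heis R n).
Local Notation leb := (lebesgue_tuple R (n + n + 1)).
Local Notation tup F := (@row_of_tuple R (n + n + 1) @^-1` F).

Let shift (h : H) := affine_tuple (translation_mx h) h.

Let row_shift h t : row_of_tuple (shift h t) = hmul h (row_of_tuple t).
Proof. by rewrite row_affine_tuple addrC -hmul_translation. Qed.

Let leb_shift h A : measurable A -> leb (shift h @^-1` A) = leb A.
Proof.
move=> mA; rewrite -[RHS](lebesgue_affine_tuple h (translation_mx_triangular h) mA).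
by rewrite det_translation_mx mul1e.
Qed.

(* F is covered by the pieces that the lattice elements h move into F', and the
   moved pieces are disjoint. *)
Lemma fundamental_domain_le (Gam : lattice R n) (F F' : set H) :
  countable (carrier Gam) -> fundamental_domain Gam F -> borel F' ->
  (forall p, exists2 h, carrier Gam h & F' (hmul h p)) ->
  (leb (tup F) <= leb (tup F'))%E.
Proof.
move=> /countable_injP[code codeI] [mF Frep] mF' F'cov.
(* [k] stands for the lattice element that it encodes; if there is none, both pieces are empty. *)
pose A k := [set t | F (row_of_tuple t) /\
  exists h, [/\ carrier Gam h, code h = k & F' (hmul h (row_of_tuple t))]].
pose B k := [set t | F' (row_of_tuple t) /\
  exists h, [/\ carrier Gam h, code h = k & F (hmul (- h) (row_of_tuple t))]].
have AB k : measurable (A k) /\ measurable (B k) /\ leb (A k) = leb (B k).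
  have [[h [Gh hk]]|noh] := pselect (exists h, carrier Gam h /\ code h = k); last first.
    have -> : A k = set0.
      by apply/seteqP; split => // t [_ [h [Gh hk _]]]; apply: noh; exists h.
    have -> : B k = set0.
      by apply/seteqP; split => // t [_ [h [Gh hk _]]]; apply: noh; exists h.
    by [].
  have huniq h' : carrier Gam h' -> code h' = k -> h' = h.
    by move=> Gh' h'k; apply: codeI; rewrite ?inE// hk.
  have BE : B k = tup F' `&` shift (- h) @^-1` (tup F).
    apply/seteqP; split => t /=; rewrite /preimage /= row_shift.
      by move=> [F't [h' [Gh' /huniq -> // Fh]]].
    by move=> [F't Fh]; split => //; exists h.
  have AE : A k = shift h @^-1` (B k).
    apply/seteqP; split => t; rewrite /A /B /preimage /mkset row_shift.
      move=> [Ft [h' [Gh' h'k F'h]]]; rewrite (huniq _ Gh' h'k) in F'h.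
      by split => //; exists h; split => //; rewrite hmulA hmulNp hmul0p.
    move=> [F't [h' [Gh' h'k Fh]]]; rewrite (huniq _ Gh' h'k) hmulA hmulNp hmul0p in Fh.
    by split => //; exists h.
  have mB : measurable (B k).
    by rewrite BE; apply: measurableI => //; exact: measurable_preimage_affine_tuple.
  split; first by rewrite AE; exact: measurable_preimage_affine_tuple.
  by split=> //; rewrite AE leb_shift.
have FA : tup F `<=` \bigcup_k A k.
  move=> t Ft; have [h Gh F'h] := F'cov (row_of_tuple t).
  by exists (code h) => //; split => //; exists h.
have BF' : \bigcup_k B k `<=` tup F' by move=> t [k _ []].
have tB : trivIset setT B.
  apply/trivIsetP => i j _ _ ij; apply/seteqP; split => // t.
  move=> [[_ [h [Gh hi Fh]]] [_ [h' [Gh' hj Fh']]]].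
  have [p [_ puniq]] := Frep (\pi_(heis_quot Gam) (row_of_tuple t)).
  have ph x : carrier Gam x -> F (hmul (- x) (row_of_tuple t)) ->
      p = hmul (- x) (row_of_tuple t).
    move=> Gx Fx; apply: puniq; split => //; apply/eq_quotP.
    by exists x => //; rewrite hmulA hmulpN hmul0p.
  have E : hmul (- h) (row_of_tuple t) = hmul (- h') (row_of_tuple t).
    by rewrite -(ph _ Gh Fh) -(ph _ Gh' Fh').
  have : - h = - h'.
    have := congr1 (fun x => hmul x (- row_of_tuple t)) E.
    by rewrite -!hmulA hmulpN !hmulp0.
  by move=> /oppr_inj hh; move: ij; rewrite -hi -hj hh eqxx.
apply: (@le_trans _ _ (\sum_(k <oo) leb (A k))%E).
  by apply: measure_sigma_subadditive => // k; case: (AB k).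
rewrite (eq_eseriesr (g := fun k => leb (B k))); last by move=> k _; case: (AB k) => _ [].
rewrite -measure_semi_bigcup//; first last.
- by apply: bigcupT_measurable => k; case: (AB k) => _ [].
- by move=> k; case: (AB k) => _ [].
apply: le_measure => //; rewrite inE//.
by apply: bigcupT_measurable => k; case: (AB k) => _ [].
Qed.

Variables (Gam : lattice R n) (g : H -> 'M[R]_(n + n + 1)) (L : 'M[R]_(n + n + 1)).
Variables (D c : R).
Hypothesis D0 : 0 < D.
Hypothesis c0 : 0 < c.
Hypothesis gl : left_invariant g.
Hypothesis Ltr : upper_triangular L.
Hypothesis gL : g 0 = L *m L^T.
Hypothesis net : forall x : 'rV[R]_(n + n), exists2 h, carrier Gam h &
  dot (x - hor L h) (x - hor L h) <= D ^+ 2.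
Hypothesis Gc : carrier Gam (central n c).
Hypothesis Gcount : countable (carrier Gam).

Let Lc := central_length L.

(** Bounds in the orthonormal coordinates [p *m L]: the net brings the horizontal ones into
    [[-D, D]], and powers of the central element bring the last one into one period
    [[0, c * Lc]]. *)
Let lo (i : 'I_(n + n + 1)) : R := if fintype.split i is inl _ then - D else 0.
Let hi (i : 'I_(n + n + 1)) : R := if fintype.split i is inl _ then D else c * Lc.

Let lohi i : lo i <= hi i.
Proof.
rewrite /lo /hi; case: (fintype.split i) => _; first by have := D0; lra.
by rewrite mulr_ge0 ?ltW// central_length_gt0.
Qed.

Let prod_lohi : \prod_i (hi i - lo i) = (2 * D) ^+ (n + n) * (c * Lc).
Proof.
rewrite big_split_ord /= big_ord1; congr (_ * _); last first.
  by rewrite /hi /lo (unsplitK (inr _)) subr0.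
under eq_bigr => i _ do rewrite /hi /lo (unsplitK (inl i)).
by rewrite prodr_const card_ord; congr (_ ^+ _); ring.
Qed.

Let box := [set p : H | forall i, (p *m L) ord0 i \in `[lo i, hi i]].

Let borel_box : borel box.
Proof.
have := measurable_preimage_affine_tuple L 0 (measurable_box lo hi).
congr (measurable _); apply/seteqP.
by split => t H i; have := H i; rewrite tnth_mktuple addr0.
Qed.

Let box_cover p : exists2 h, carrier Gam h & box (hmul h p).
Proof.
have [h Gh hD] := net (- hor L p).
pose q := hmul h p; pose s := (q *m L) ord0 (rshift (n + n) 0).
have cL0 : 0 < c * Lc by rewrite mulr_gt0 ?central_length_gt0.
pose j : int := - Num.floor (s / (c * Lc)).
exists (hmul (j%:~R *: central n c) h).
  by apply: carrierM => //; apply: carrierZ => //; exact: intr_int.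
rewrite -hmulA -/q -centralZ hmul_centrall => i.
have addE (a b : H) : (a + b) ord0 i = a ord0 i + b ord0 i by rewrite mxE.
rewrite mulmxDl (central_mulL Ltr) -/Lc addE {addE}.
rewrite /lo /hi; case: (split_ordP i) => i' ->.
  have -> : central n (j%:~R * c * Lc) ord0 (lshift 1 i') = 0.
    by rewrite /central row_mxEl mxE.
  have hq : hor L q ord0 i' = (q *m L) ord0 (lshift 1 i') by rewrite /hor mxE.
  have := le_trans (dot_coord _ i') hD; rewrite -opprD addrC -(hor_hmul Ltr) -/q.
  rewrite addr0 -hq mxE sqrrN -real_normK ?num_real//.
  by rewrite ler_pXn2r// ?nnegrE ?(ltW D0)// in_itv /= ler_norml.
have -> : central n (j%:~R * c * Lc) ord0 (rshift (n + n) i') = j%:~R * (c * Lc).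
  by rewrite /central row_mxEr mxE mulrA.
have -> : (q *m L) ord0 (rshift (n + n) i') = s by rewrite (ord1 i').
rewrite in_itv /=.
have [fl fg] : (Num.floor (s / (c * Lc)))%:~R * (c * Lc) <= s /\
    s < ((Num.floor (s / (c * Lc)))%:~R + 1) * (c * Lc).
  split; first by rewrite -ler_pdivlMr// floor_le.
  by rewrite -ltr_pdivrMr// -(@intrD R _ 1) floorD1_gt.
by rewrite /j mulrNz; apply/andP; split; lra.
Qed.

(** The volume density is the constant [\det L], so the box has volume the product of its edges in
    the coordinates [p *m L]. *)
Lemma riemannian_volume_le F : fundamental_domain Gam F ->
  (riemannian_volume g F <= ((2 * D) ^+ (n + n) * (c * central_length L))%:E)%E.
Proof.
move=> fF; have detL0 : 0 < \det L.
  by rewrite upper_triangular_det//; apply: prodr_gt0 => i _; case: Ltr.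
rewrite /riemannian_volume (eq_integral (cst (\det L)%:E)); last first.
  move=> t _; rewrite (det_left_invariant gl) gL det_mulmx det_tr -expr2.
  by rewrite sqrtr_sqr gtr0_norm.
rewrite integral_cst; last by case: fF.
rewrite -prod_lohi -(lebesgue_parallelepiped Ltr lohi).
apply: lee_wpmul2l; first by rewrite lee_fin ltW.
exact: (fundamental_domain_le Gcount fF borel_box box_cover).
Qed.

End fundamental_domains.

(** * The bound on the commutator matrix *)

Section commutator_bound.
Context (R : realType) (n : nat) (D V K : R).
Hypotheses (hn : (1 <= n)%N) (hD : 0 < D) (hV : 0 < V).
Local Notation H := (heis R n).

(** Write [W] for [(2 * (D + 1)) ^+ (n + n)], [Lc] for the central length and [a] for an entry of
    [A]. The bound combines [V <= W * (c * Lc)] with the Ricci estimate of [Lc ^+ 2 * (a * c) ^+ 2]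
    on vectors of squared length at most [basis_radius n (D + 1)]; the unknown [c * Lc] cancels. *)
Definition commutator_bound : R :=
  ((2 * (D + 1)) ^+ (n + n)) ^+ 2 * (2 * `|K| * basis_radius n (D + 1) ^+ 2) / V ^+ 2.

Lemma bounded_adapted_frame (Gam : lattice R n) (g : H -> 'M[R]_(n + n + 1)) :
  riemannian_metric g -> left_invariant g -> (quot_diam Gam g <= D%:E)%E ->
  (V%:E <= quot_meas Gam g)%E -> ricci_ge g K ->
  exists G c A, adapted_frame Gam G c A /\
    forall i j, ((A i j)%:~R : R) ^+ 2 <= commutator_bound.
Proof.
move=> gm gl gD gV gK; have [gs gsym gpos] := gm.
have gT : (g 0)^T = g 0.
  apply: inner_ext => u v; rewrite -[RHS]/(inner g 0 u v) gsym /inner.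
  have -> : u *m (g 0)^T *m v^T = (v *m g 0 *m u^T)^T by rewrite !trmx_mul trmxK mulmxA.
  by rewrite mxE.
have [L Ltr gL] := cholesky gT (gpos 0).
have D1 : 0 < D + 1 by rewrite addr_gt0.
have net := hor_net hD gm gl Ltr gL gD.
have [G [Gu SG Gr]] := short_basis D1 Ltr net.
have gram_int i j z : symp_gram G i j = z -> carrier Gam (central n z).
  move=> <-; rewrite mxE -hmul_commutator.
  by apply: carrierM; apply: carrierM => //; exact: carrierN.
have Gramu := symp_gram_unit Gu (oner_neq0 R).
have kn : (0 < n + n)%N by rewrite addn_gt0 hn.
(* As [n >= 1], the invertible Gram matrix has a nonzero entry: a nontrivial commutator, which shows
   that the lattice meets the centre nontrivially. *)
have [j0 gram0] : exists j, symp_gram G (Ordinal kn) j != 0.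
  apply/existsP; apply: contraT; rewrite negb_exists => /forallP g0.
  have : row (Ordinal kn) (symp_gram G) = 0.
    by apply/rowP => j; rewrite [LHS]mxE [RHS]mxE; apply/eqP; rewrite -[_ == _]negbK g0.
  rewrite rowE => /(congr1 (mulmx^~ (invmx (symp_gram G)))); rewrite mulmxK// mul0mx.
  move=> /rowP/(_ (Ordinal kn)); rewrite !mxE !eqxx => /eqP.
  by rewrite oner_eq0.
have [c c0 Cc] : exists2 c, 0 < c & forall z,
    carrier Gam (central n z) <-> z / c \is a Num.int.
  by case: Gam gD gV net SG gram_int => S Sd Sc /= *; apply: (centre_generator Sd _ gram0); eauto.
pose A : 'M[int]_(n + n) := \matrix_(i, j) Num.floor (symp_gram G i j / c).
have GA : symp_gram G = c *: map_mx intr A.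
  apply/matrixP => i j; rewrite [RHS]mxE [X in c * X]mxE [A i j]mxE floorK.
    by rewrite mulrCA mulfV ?mulr1// gt_eqF.
  exact/Cc/gram_int.
have fr : adapted_frame Gam G c A by split=> //; rewrite gt_eqF.
exists G, c, A; split => // i j.
have Lc0 := central_length_gt0 Ltr; set Lc := central_length L in Lc0.
have Gcc : carrier Gam (central n c) by apply/Cc; rewrite divff ?gt_eqF// rpred1.
have VW : V <= (2 * (D + 1)) ^+ (n + n) * (c * Lc).
  rewrite -lee_fin; apply: (le_trans gV); apply: ge_ereal_sup => _ [F fF <-].
  exact: (riemannian_volume_le D1 c0 gl Ltr gL net Gcc (adapted_frame_countable fr)).
set W := (2 * (D + 1)) ^+ (n + n) in VW.
have W0 : 0 < W by rewrite exprn_gt0//; lra.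
have AE : (A i j)%:~R * c = symp (row i G) (row j G).
  have := congr1 (fun M : 'M[R]_(n + n) => M i j) GA.
  by rewrite !mxE mulrC => <-.
have := symp_hor_le gl Ltr gL gK (row i G) (row j G); rewrite -AE -/Lc.
set a := ((A i j)%:~R : R); set x := dot _ _; set y := dot _ _ => Kxy.
have xy : x * y <= basis_radius n (D + 1) ^+ 2.
  by rewrite expr2; apply: ler_pM; rewrite ?dot_ge0 ?Gr.
have xy0 : 0 <= x * y by rewrite mulr_ge0 ?dot_ge0.
have Ka : Lc ^+ 2 * (a * c) ^+ 2 <= 2 * `|K| * basis_radius n (D + 1) ^+ 2.
  apply: (le_trans Kxy); apply: (@le_trans _ _ (2 * `|K| * (x * y))).
    by apply: ler_wpM2r => //; have := ler_norm (- K); rewrite normrN; lra.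
  by apply: ler_wpM2l => //; rewrite mulr_ge0.
rewrite /commutator_bound -/W ler_pdivlMr ?exprn_gt0//.
apply: (@le_trans _ _ (W ^+ 2 * (Lc ^+ 2 * (a * c) ^+ 2))); last first.
  by rewrite ler_wpM2l// sqr_ge0.
have V2 : V ^+ 2 <= (W * (c * Lc)) ^+ 2.
  by rewrite ler_pXn2r// ?nnegrE ?ltW// !mulr_gt0.
apply: (le_trans (ler_wpM2l (sqr_ge0 a) V2)).
by rewrite le_eqVlt; apply/orP; left; apply/eqP; ring.
Qed.

End commutator_bound.

Theorem proposition1p1 (R : realType) (n : nat) (D V K : R)
    (hn : (1 <= n)%N) (hD : 0 < D) (hV : 0 < V) :
  finite_set [set diffeo_class Gam | Gam in [set Gam : lattice R n |
    exists g : heis R n -> 'M[R]_(n + n + 1),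
      [/\ riemannian_metric g, left_invariant g,
          (quot_diam Gam g <= D%:E)%E,
          (V%:E <= quot_meas Gam g)%E &
          ricci_ge g K]]].
Proof.
pose C := commutator_bound n D V K.
apply: (@finite_diffeo_classes R n (Num.bound C)) => Gam [g [gm gl gD gV gK]].
have [G [c [A [fr AC]]]] := bounded_adapted_frame hn hD hV gm gl gD gV gK.
exists G, c, A; split => // i j.
have Cb : C < (Num.bound C)%:R.
  by apply: archi_boundP; apply: le_trans (AC i j); exact: sqr_ge0.
have := le_lt_trans (AC i j) Cb.
rewrite -rmorphXn /= pmulrn ltr_int => A2.
(* The absolute value of an integer is at most its square. *)
nia.
Qed.
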